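(* Let $X=(X_1,X_2)^\top\sim\mathcal N_2(\boldsymbol\mu,\boldsymbol\Sigma)$ be a bivariate normal random vector with mean $\boldsymbol\mu=(\mu_1,\mu_2)^\top\in\mathbb R^2$ and covariance matrix $\boldsymbol\Sigma$ having diagonal elements $\sigma_1^2,\sigma_2^2$ and off-diagonal element $\rho\sigma_1\sigma_2$, where $\sigma_1,\sigma_2>0$ and $|\rho|<1$. With the constants and functions defined in the context, the cumulative distribution function of $R=\sqrt{X_1^2+X_2^2}$ is $$F_R(u;\boldsymbol\mu,\boldsymbol\Sigma)=\frac{\alpha}{2}\sum_{j=0}^\infty\epsilon_j\cos(2j\delta)\left(\frac{\eta\psi^2}{8}\right)^j\sum_{k_1=0}^\infty\sum_{k_2=0}^\infty C(k_1,k_2,j;\psi,\eta)\,\frac{u^{2\ell_{k_1,k_2}^{(j)}+2}}{\ell_{k_1,k_2}^{(j)}+1}\;{}_1F_1\!\left(\ell_{k_1,k_2}^{(j)}+1,\ \ell_{k_1,k_2}^{(j)}+2,\ -\beta u^2\right)$$ for $u>0$, and is zero for $u\le 0$.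
   Context: ${}_1F_1(a,b,z)=\sum_{n\ge0}\frac{a(a+1)\cdots(a+n-1)}{b(b+1)\cdots(b+n-1)}\frac{z^n}{n!}$ is Kummer's confluent hypergeometric function of the first kind. $\epsilon_0=1$ and $\epsilon_j=2$ for $j\ge1$. The constants are $$\alpha=\frac{1}{\sigma_1\sigma_2\sqrt{1-\rho^2}}\exp\left(-\frac{\mu_1^2\sigma_2^2+\sigma_1^2\mu_2^2-2\rho\sigma_1\sigma_2\mu_1\mu_2}{2\sigma_1^2\sigma_2^2(1-\rho^2)}\right),\qquad \beta=\frac{\sigma_1^2+\sigma_2^2}{4\sigma_1^2\sigma_2^2(1-\rho^2)},$$ $$\eta=\frac{\sqrt{(\sigma_2^2-\sigma_1^2)^2+4\sigma_1^2\sigma_2^2\rho^2}}{4\sigma_1^2\sigma_2^2(1-\rho^2)},\qquad \psi=\frac{\sqrt{\sigma_1^2(\rho\mu_1\sigma_2-\mu_2\sigma_1)^2+\sigma_2^2(\rho\mu_2\sigma_1-\mu_1\sigma_2)^2}}{\sigma_1^2\sigma_2^2(1-\rho^2)},$$ and $\delta=\tilde\phi-\phi/2$, where the angles $\tilde\phi,\phi$ satisfy $$\cos\tilde\phi=\frac{\mu_2\sigma_1^2-\rho\mu_1\sigma_1\sigma_2}{D},\quad \sin\tilde\phi=\frac{\mu_1\sigma_2^2-\rho\mu_2\sigma_1\sigma_2}{D},\quad D=\sqrt{\mu_1^2\sigma_2^4+\mu_2^2\sigma_1^4+\rho^2\sigma_1^2\sigma_2^2(\mu_1^2+\mu_2^2)-2\rho\mu_1\mu_2\sigma_1\sigma_2(\sigma_1^2+\sigma_2^2)},$$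 $$\cos\phi=\frac{\sigma_2^2-\sigma_1^2}{\sqrt{(\sigma_1^2-\sigma_2^2)^2+4\rho^2\sigma_1^2\sigma_2^2}},\quad \sin\phi=\frac{2\rho\sigma_1\sigma_2}{\sqrt{(\sigma_1^2-\sigma_2^2)^2+4\rho^2\sigma_1^2\sigma_2^2}}.$$ If the denominator in the definition of $\tilde\phi$ (i.e. $\psi=0$) or of $\phi$ (i.e. $\eta=0$) vanishes, the corresponding angle is arbitrary. For nonnegative integers $k_1,k_2,j$ put $\ell_{k_1,k_2}^{(j)}=k_1+2k_2+2j$ and $$C(k_1,k_2,j;\psi,\eta)=\frac{\psi^{2k_1}\eta^{2k_2}}{4^{k_1+k_2}k_1!\,(k_1+2j)!\,k_2!\,(k_2+j)!}.$$ Convention: $0^0=1$. *)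

(* Defs.v *)
From HB Require Import structures.
From mathcomp Require Import all_boot all_order all_algebra.
From mathcomp Require Import all_classical all_reals all_analysis.
From mathcomp Require Import measurable_realfun.

Set Implicit Arguments.
Unset Strict Implicit.
Unset Printing Implicit Defensive.
Import Order.TTheory GRing.Theory Num.Theory.
Import numFieldNormedType.Exports.

Local Open Scope classical_set_scope.
Local Open Scope ring_scope.

Section bivariate_normal.
Context {R : realType}.

Definition vec2 (a b : R) : 'cV[R]_2 := \col_i (if i == ord0 then a else b).

Definition cov2 (s1 s2 rho : R) : 'M[R]_2 :=
  \matrix_(i, j)
    (if i == j then (if i == ord0 then s1 else s2) ^+ 2 else rho * s1 * s2).

Definition normal2_pdf (mu : 'cV[R]_2) (Sigma : 'M[R]_2) (x : (R * R)%type) : R :=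
  let v := vec2 x.1 x.2 - mu in
  (2 * pi * Num.sqrt (\det Sigma))^-1 *
  expR (- ((v^T *m invmx Sigma *m v) 0 0 / 2)).

(* The law N_2(mu, Sigma), given by its density with respect to the Lebesgue
   measure on R * R; meant for positive definite Sigma only. *)
Definition is_normal2 {d : measure_display} {T : measurableType d}
    (P : probability T R) (X : {RV P >-> (R * R)%type})
    (mu : 'cV[R]_2) (Sigma : 'M[R]_2) : Prop :=
  forall A : set (R * R)%type, measurable A ->
    distribution P X A =
    (\int[lebesgue_measure \x lebesgue_measure]_(x in A)
       (normal2_pdf mu Sigma x)%:E)%E.

Definition radius {d : measure_display} {T : measurableType d}
    (P : probability T R) (X : {RV P >-> (R * R)%type}) : T -> R :=
  fun w => Num.sqrt ((X w).1 ^+ 2 + (X w).2 ^+ 2).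

Lemma measurable_radius {d : measure_display} {T : measurableType d}
    (P : probability T R) (X : {RV P >-> (R * R)%type}) :
  measurable_fun [set: T] (radius X).
Proof.
apply: (measurableT_comp (f := @Num.sqrt R)).
  by apply: continuous_measurable_fun; exact: sqrt_continuous.
apply: measurable_funD; apply: measurable_funX.
- exact: (measurableT_comp measurable_fst).
- exact: (measurableT_comp measurable_snd).
Qed.

HB.instance Definition _ {d : measure_display} {T : measurableType d}
    (P : probability T R) (X : {RV P >-> (R * R)%type}) :=
  isMeasurableFun.Build _ _ T R (radius X) (measurable_radius X).

Definition radiusRV {d : measure_display} {T : measurableType d}
    (P : probability T R) (X : {RV P >-> (R * R)%type}) : {RV P >-> R} := radius X.

End bivariate_normal.

Section constants.
Context {R : realType}.

(* The value limn is meaningful when b is not a nonpositive integer, in which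
   case the series converges for every z. *)
Definition kummer (a b z : R) : R :=
  limn (series (fun n : nat =>
    (\prod_(i < n) (a + i%:R)) / (\prod_(i < n) (b + i%:R)) *
    (z ^+ n / n`!%:R))).

Definition neumann (j : nat) : R := if j == 0%N then 1 else 2.

Variables mu1 mu2 s1 s2 rho : R.

Definition alpha : R :=
  (s1 * s2 * Num.sqrt (1 - rho ^+ 2))^-1 *
  expR (- ((mu1 ^+ 2 * s2 ^+ 2 + s1 ^+ 2 * mu2 ^+ 2
            - 2 * rho * s1 * s2 * mu1 * mu2)
           / (2 * s1 ^+ 2 * s2 ^+ 2 * (1 - rho ^+ 2)))).

Definition beta : R :=
  (s1 ^+ 2 + s2 ^+ 2) / (4 * s1 ^+ 2 * s2 ^+ 2 * (1 - rho ^+ 2)).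

Definition eta : R :=
  Num.sqrt ((s2 ^+ 2 - s1 ^+ 2) ^+ 2 + 4 * s1 ^+ 2 * s2 ^+ 2 * rho ^+ 2)
  / (4 * s1 ^+ 2 * s2 ^+ 2 * (1 - rho ^+ 2)).

Definition psi : R :=
  Num.sqrt (s1 ^+ 2 * (rho * mu1 * s2 - mu2 * s1) ^+ 2
            + s2 ^+ 2 * (rho * mu2 * s1 - mu1 * s2) ^+ 2)
  / (s1 ^+ 2 * s2 ^+ 2 * (1 - rho ^+ 2)).

Definition phit_den : R :=
  Num.sqrt (mu1 ^+ 2 * s2 ^+ 4 + mu2 ^+ 2 * s1 ^+ 4
            + rho ^+ 2 * s1 ^+ 2 * s2 ^+ 2 * (mu1 ^+ 2 + mu2 ^+ 2)
            - 2 * rho * mu1 * mu2 * s1 * s2 * (s1 ^+ 2 + s2 ^+ 2)).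

(* Angles are only determined modulo 2 pi, and are arbitrary when the
   denominator vanishes; hence predicates rather than functions. *)
Definition is_phit (phit : R) : Prop :=
  phit_den != 0 ->
  cos phit = (mu2 * s1 ^+ 2 - rho * mu1 * s1 * s2) / phit_den /\
  sin phit = (mu1 * s2 ^+ 2 - rho * mu2 * s1 * s2) / phit_den.

Definition phi_den : R :=
  Num.sqrt ((s1 ^+ 2 - s2 ^+ 2) ^+ 2 + 4 * rho ^+ 2 * s1 ^+ 2 * s2 ^+ 2).

Definition is_phi (phi : R) : Prop :=
  phi_den != 0 ->
  cos phi = (s2 ^+ 2 - s1 ^+ 2) / phi_den /\
  sin phi = (2 * rho * s1 * s2) / phi_den.

End constants.

Definition ell (k1 k2 j : nat) : nat := (k1 + 2 * k2 + 2 * j)%N.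

Definition Ccoef {R : realType} (k1 k2 j : nat) (psi eta : R) : R :=
  (psi ^+ (2 * k1) * eta ^+ (2 * k2)) /
  (4 ^+ (k1 + k2) * k1`!%:R * (k1 + 2 * j)`!%:R * k2`!%:R * (k2 + j)`!%:R).

Section radius_series.
Context {R : realType}.
Variables mu1 mu2 s1 s2 rho delta u : R.

Let b := beta s1 s2 rho.
Let e := eta s1 s2 rho.
Let p := psi mu1 mu2 s1 s2 rho.

Definition inner_term (j k1 k2 : nat) : R :=
  let l := ell k1 k2 j in
  Ccoef k1 k2 j p e * (u ^+ (2 * l + 2) / (l%:R + 1)) *
  kummer (l%:R + 1) (l%:R + 2) (- b * u ^+ 2).

Definition middle_term (j k1 : nat) : R := limn (series (inner_term j k1)).

Definition outer_term (j : nat) : R :=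
  neumann j * cos (2 * j%:R * delta) * (e * p ^+ 2 / 8) ^+ j *
  limn (series (middle_term j)).

End radius_series.

(* Main.v *)
Require Import Defs.
From HB Require Import structures.
From mathcomp Require Import all_boot all_order all_algebra.
From mathcomp Require Import all_classical all_reals all_analysis.
From mathcomp Require Import ring lra zify measurable_realfun.

Set Implicit Arguments.
Unset Strict Implicit.
Unset Printing Implicit Defensive.
Import Order.TTheory GRing.Theory Num.Theory.
Import numFieldNormedType.Exports.

Local Open Scope classical_set_scope.
Local Open Scope ring_scope.

(** In polar coordinates x = s cos t, y = s sin t the normal density becomes
    alpha / (2 pi) exp(- beta s^2) exp(psi s cos t') exp(eta s^2 cos(2 (t' - delta)))
    with the shifted angle t' = t + phit - pi / 2.  This is where all the
    constants come from: beta, eta and phi give the quadratic form in s^2 and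
    the double angle 2 t, while psi and phit are the polar coordinates of the
    linear form (normal2_pdf_polar).  The law of the radius at u is the integral
    of this function against s ds dt over s <= u.

    The angle is integrated out with the Jacobi-Anger expansion
    exp(z cos t) = sum_j eps_j I_j(z) cos(j t), where
    I_j(z) = sum_k (z/2)^(2k+j) / (k! (k+j)!) is the modified Bessel function
    (jacobi_anger).  Applied to both exponentials, and because the products
    cos(i t') cos(2j (t' - delta)) integrate to 0 over a full turn unless
    i = 2j, it leaves
    2 pi sum_j eps_j cos(2 j delta) I_j(eta s^2) I_2j(psi s)
    (angular_integral).  Expanding both Bessel functions in powers of s leaves
    the radial integrals of s^(2l+1) exp(- beta s^2) over [0, u], which are the
    Kummer functions of the statement (Rintegral_kummer).

    Every interchange of sum and integral is an instance of
    cvg_series_Rintegral: on a bounded interval a series whose terms are bounded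
    by a summable sequence of constants integrates term by term.  In the radial
    variable the constants are read off at s = u, where the powers of s are
    largest and the exponential exp(- beta s^2) is replaced by 1; in the angle
    they come from the bound of the cosines by 1.

    Polar coordinates are obtained from one-dimensional substitutions: Tonelli
    with y = x t, then x = s cos (atan t), and finally the angle atan t for fixed s
    (ge0_integral_polar, integral_atan, ge0_integral_disk).  The variable s
    there is signed, the angle ranging over a half turn; folding s onto [0, u]
    pairs each direction with the opposite one. *)

(** * Series of real numbers and termwise integration *)

Section series_facts.
Context {R : realType}.

Lemma cvg_series_eseries (a : R ^nat) (l : R) :
  series a @ \oo --> l -> (\sum_(k <oo) (a k)%:E)%E = l%:E.
Proof.
move=> al; rewrite (_ : (fun n => _) = EFin \o series a).
  by rewrite EFin_lim; [rewrite (cvg_lim _ al)|exact: cvgP al].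
by apply/funext => n; rewrite /series/= sumEFin.
Qed.

Lemma eseries_cvg_series (a : R ^nat) (l : R) : (forall k, 0 <= a k) ->
  (\sum_(k <oo) (a k)%:E)%E = l%:E -> series a @ \oo --> l.
Proof.
move=> a0 al.
have ca : cvgn (series a) by apply: nnseries_is_cvg => //; rewrite al ltry.
by have := cvg_series_eseries ca; rewrite al => -[->].
Qed.

Lemma series_ge0_le (a : R ^nat) (l : R) k : (forall k, 0 <= a k) ->
  series a @ \oo --> l -> a k <= l.
Proof.
move=> a0 al; have := cvg_series_eseries al.
move=> al'; rewrite -lee_fin -al'.
apply: (@le_trans _ _ (\sum_(0 <= i < k.+1) (a i)%:E)%E).
  rewrite sumEFin lee_fin big_nat_recr//= lerDr sumr_ge0//.
by apply: nneseries_lim_ge => i _; rewrite lee_fin.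
Qed.

Lemma eq_cvg_series (a b : R ^nat) (l m : R) : a =1 b -> l = m ->
  series a @ \oo --> l -> series b @ \oo --> m.
Proof. by move=> /funext -> ->. Qed.

Lemma cvg_seriesM (c : R) (a : R ^nat) (l : R) :
  series a @ \oo --> l -> series (fun k => c * a k) @ \oo --> c * l.
Proof.
move=> al; rewrite (_ : series _ = fun n => c * series a n).
  exact: cvgMl_tmp.
by apply/funext => n; rewrite /series/= big_distrr.
Qed.

Lemma cvg_seriesB (a b : R ^nat) (l m : R) :
  series a @ \oo --> l -> series b @ \oo --> m ->
  series (fun k => a k - b k) @ \oo --> l - m.
Proof.
move=> al bm; rewrite (_ : series _ = fun n => series a n - series b n).
  exact: cvgB.
by apply/funext => n; rewrite /series/= sumrB.
Qed.

Lemma cvg_seriesD (a b : R ^nat) (l m : R) :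
  series a @ \oo --> l -> series b @ \oo --> m ->
  series (fun k => a k + b k) @ \oo --> l + m.
Proof.
move=> al bm; rewrite (_ : series _ = fun n => series a n + series b n).
  exact: cvgD.
by apply/funext => n; rewrite /series/= big_split.
Qed.

(** Tonelli for double series of nonnegative reals: if the iterated sum by
    rows converges to S, then the columns converge and so does their sum, to
    the same S.  The existence of the column sums is part of the conclusion, so
    that convergence of a family of series can be read off from a single
    convergent rearrangement. *)
Lemma series_tonelli (a : nat -> nat -> R) (r : R ^nat) (S : R) :
  (forall i j, 0 <= a i j) ->
  (forall i, series (a i) @ \oo --> r i) -> series r @ \oo --> S ->
  exists2 c : R ^nat,
    forall j, series (a^~ j) @ \oo --> c j & series c @ \oo --> S.
Proof.
move=> a0 ar rS.
have r0 i : 0 <= r i by exact: le_trans (a0 i 0) (series_ge0_le 0 _ (ar i)).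
have rowE : (\sum_(i <oo) \sum_(j <oo) (a i j)%:E)%E = S%:E.
  rewrite -(cvg_series_eseries rS); apply: eq_eseriesr => i _.
  exact: cvg_series_eseries.
rewrite nneseries_interchange in rowE; last by move=> i j; rewrite lee_fin.
have c0 j : (0 <= \sum_(i <oo) (a i j)%:E)%E.
  by apply: nneseries_ge0 => i _ _; rewrite lee_fin.
have cfin j : (\sum_(i <oo) (a i j)%:E)%E \is a fin_num.
  rewrite ge0_fin_numE//; apply: (@le_lt_trans _ _ S%:E); last by rewrite ltry.
  rewrite -rowE; apply: (@le_trans _ _
    (\sum_(0 <= k < j.+1) \sum_(i <oo) (a i k)%:E)%E).
    rewrite big_nat_recr//= leeDr// sume_ge0// => i _.
  exact: nneseries_lim_ge.
exists (fun j => fine (\sum_(i <oo) (a i j)%:E)%E).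
  by move=> j; apply: eseries_cvg_series => //; rewrite fineK.
apply: eseries_cvg_series => [j|]; first exact: fine_ge0.
by rewrite -rowE; apply: eq_eseriesr => j _; rewrite fineK.
Qed.

End series_facts.

Section termwise_integration.
Context {R : realType}.
Notation mu := (@lebesgue_measure R).

Lemma bounded_integrable (a b M : R) (f : R -> R) :
  measurable_fun `[a, b] f -> {in `[a, b], forall x, `|f x| <= M} ->
  mu.-integrable `[a, b] (EFin \o f).
Proof.
move=> mf fM.
apply: measurable_bounded_integrable => //.
  rewrite /= lebesgue_measure_itv/=; case: ifPn => _; last by rewrite ltry.
  by rewrite -EFinB ltry.
exists M; split; [exact: num_real|move=> N MN x /= xab].
exact: le_trans (fM x xab) (ltW MN).
Qed.

Lemma integrable_measurable_fun (D : set R) (f : R -> R) :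
  mu.-integrable D (EFin \o f) -> measurable_fun D f.
Proof. by move=> /measurable_int/measurable_EFinP. Qed.

(** The partial sums are bounded by the sum of the M k, a constant, which is
    integrable on a bounded interval: this is dominated convergence.  Only the
    bounds M k have to be summed, never an integral of the terms. *)
Lemma cvg_series_Rintegral (a b : R) (f : nat -> R -> R) (F : R -> R)
    (M : R ^nat) :
  (forall k, measurable_fun `[a, b] (f k)) ->
  (forall k, {in `[a, b], forall x, `|f k x| <= M k}) ->
  cvgn (series M) ->
  {in `[a, b], forall x, series (f^~ x) @ \oo --> F x} ->
  mu.-integrable `[a, b] (EFin \o F) /\
  series (fun k => \int[mu]_(x in `[a, b]) f k x) @ \oo -->
    \int[mu]_(x in `[a, b]) F x.
Proof.
move=> mf fM cM fF.
pose s n x := series (f^~ x) n.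
have ms n : measurable_fun `[a, b] (s n) by exact: measurable_sum.
have mF : measurable_fun `[a, b] F.
  by apply: (measurable_fun_cvg ms) => x xab; exact: fF.
have fi k : mu.-integrable `[a, b] (EFin \o f k).
  by apply: (@bounded_integrable _ _ (M k)).
(* On an empty interval the bounds do not force M k to be nonnegative. *)
have [[c cab]|ab0] := pselect (exists c : R, c \in `[a, b]); last first.
  have -> : `[a, b]%classic = set0.
    by apply/seteqP; split => // x xab; exfalso; apply: ab0; exists x.
  split; first by apply: integrable_set0; exact: measurable_itv.
  rewrite Rintegral_set0; under eq_fun do rewrite Rintegral_set0.
  rewrite (_ : series _ = cst 0); first exact: cvg_cst.
  by apply/funext => n; rewrite /series/= big1.
have M0 k : 0 <= M k by exact: le_trans (normr_ge0 _) (fM k c cab).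
pose L := limn (series M).
have sL n x : x \in `[a, b] -> `|s n x| <= L.
  move=> xab; apply: (le_trans (ler_norm_sum _ _ _)).
  apply: (@le_trans _ _ (series M n)); first by apply: ler_sum => k _; exact: fM.
  by apply: nondecreasing_cvgn_le => //; exact: nondecreasing_series.
have si n : mu.-integrable `[a, b] (EFin \o s n).
  by apply: (@bounded_integrable _ _ L) => // x; exact: sL.
have [] := @dominated_convergence _ _ R mu `[a, b] (measurable_itv _)
  (fun n => EFin \o s n) (EFin \o F) (cst L%:E).
- move=> n; apply/measurable_EFinP; exact: ms.
- exact/measurable_EFinP.
- apply/aeW => x xab /=; apply/fine_cvgP; split; first exact: nearW.
  exact: fF.
- by apply: (@bounded_integrable _ _ `|L|); [exact: measurable_cst|].
- by apply/aeW => x n xab; rewrite lee_fin; exact: sL.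
move=> Fi _ cv; split=> //.
rewrite (_ : series _ = fun n => \int[mu]_(x in `[a, b]) s n x).
  apply: fine_cvg; rewrite /=.
  rewrite fineK; last exact: integrable_fin_num.
  exact: cv.
apply/funext => n; elim: n => [|n IH].
  rewrite /series/= big_geq// /s /series/=.
  under eq_Rintegral do rewrite big_geq//.
  by rewrite Rintegral_cst// mul0r.
rewrite seriesSr IH -RintegralD//.
by apply: eq_Rintegral => x _; rewrite /s seriesSr.
Qed.

End termwise_integration.

(** * Polar coordinates *)

Section polar_coordinates.
Context {R : realType}.
Notation mu := (@lebesgue_measure R).

Lemma nondecreasing_itv_seq (e : R -> R) :
  (forall x y, x <= y -> e x <= e y) ->
  nondecreasing_seq (fun n : nat => `[e (- n%:R), e n%:R]%classic : set R).
Proof.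
move=> he m n mn; apply/subsetPset => x /=; rewrite !in_itv/= => /andP[h1 h2].
apply/andP; split.
  by rewrite (le_trans _ h1)// he// lerN2 ler_nat.
by rewrite (le_trans h2)// he// ler_nat.
Qed.

Lemma bigcup_itv_setT :
  \bigcup_n `[- n%:R, n%:R]%classic = [set: R].
Proof.
apply/seteqP; split => // x _; exists (Num.truncn `|x|).+1 => //=.
rewrite in_itv/= -ler_norml; exact/ltW/truncnS_gt.
Qed.

Lemma bigcup_itv_atan :
  \bigcup_n `[atan (- n%:R), atan n%:R]%classic =
  `](- (pi / 2)), (pi / 2)[%classic :> set R.
Proof.
apply/seteqP; split => x /=.
  move=> [n _] /=; rewrite !in_itv/= => /andP[h1 h2].
  by rewrite (lt_le_trans (atan_gtNpi2 _) h1) (le_lt_trans h2 (atan_ltpi2 _)).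
rewrite in_itv/= => xpi; exists (Num.truncn `|tan x|).+1 => //=.
have : `|tan x| <= (Num.truncn `|tan x|).+1%:R by rewrite ltW// truncnS_gt.
rewrite ler_norml => /andP[/le_atan h1 /le_atan h2].
by rewrite !tanK// in h1 h2; rewrite in_itv/= h1 h2.
Qed.

Local Open Scope ereal_scope.

Let dil (c : R) : measurableTypeR R -> measurableTypeR R := fun t => (c * t)%R.

Let measurable_dil c : measurable_fun setT (dil c).
Proof. by apply: measurable_funM => //; exact: measurable_id. Qed.

(** The pushforward of Lebesgue measure by a dilation, packed with its
    measure structure. *)
Let dilm (c : R) : {measure set (measurableTypeR R) -> \bar R}.
Proof.
unshelve refine (pushforward mu (dil c) : {measure set _ -> \bar R}).
exact: measurable_dil.
Defined.

(** Both measures are determined by their values on half-open intervals; for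
    c < 0 the preimage of such an interval is open on the other side, which
    does not change its length. *)
Lemma lebesgue_measure_dilation (c : R) (A : set R) : (c != 0)%R ->
  measurable A -> mscale (NngNum (normr_ge0 c)) (dilm c) A = mu A.
Proof.
move=> c0 mA; apply/esym; apply: lebesgue_measure_unique => //= _ [[a b]] _ <-.
rewrite /mscale (_ : dilm c _ = mu (dil c @^-1` `]a, b]))//.
have [c_gt0|c_lt0] : (0 < c \/ c < 0)%R by apply/orP; rewrite -neq_lt eq_sym.
- have -> : dil c @^-1` `]a, b] = `](a / c)%R, (b / c)%R]%classic.
    apply/seteqP; split => x /=; rewrite !in_itv/= /dil;
      by rewrite ltr_pdivrMr// ler_pdivlMr// ![(x * c)%R]mulrC.
  rewrite /= !lebesgue_measure_itv/= !lte_fin ltr_pM2r ?invr_gt0//.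
  case: ifPn => _; last by rewrite mule0.
  by rewrite -!EFinB -EFinM gtr0_norm//; congr EFin; field.
- have -> : dil c @^-1` `]a, b] = `[(b / c)%R, (a / c)%R[%classic.
    apply/seteqP; split => x /=; rewrite !in_itv/= /dil;
      by rewrite ltr_ndivlMr// ler_ndivrMr// ![(x * c)%R]mulrC andbC.
  rewrite /= !lebesgue_measure_itv/= !lte_fin ltr_nM2r ?invr_lt0//.
  case: ifPn => _; last by rewrite mule0.
  by rewrite -!EFinB -EFinM ltr0_norm//; congr EFin; field.
Qed.

Lemma ge0_integral_dilation (c : R) (f : R -> \bar R) : (c != 0)%R ->
  measurable_fun [set: R] f -> (forall x, 0 <= f x) ->
  \int[mu]_x f x = `|c|%:E * \int[mu]_x f (c * x)%R.
Proof.
move=> c0 mf f0.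
transitivity (\int[mscale (NngNum (normr_ge0 c)) (dilm c)]_x f x).
  apply: eq_measure_integral => A mA _; apply/esym.
  exact: lebesgue_measure_dilation.
rewrite ge0_integral_mscale//=; congr (_ * _).
have := @ge0_integral_pushforward _ _ _ _ R (dil c) (measurable_dil c) mu setT f measurableT mf
  (fun x _ => f0 x).
exact.
Qed.

(** The substitution x = atan t, made on the intervals [-n, n]: they exhaust
    the line while their images exhaust the open interval of half-length pi / 2. *)
Lemma integral_atan (G : R -> R) : continuous G -> (forall x, 0 <= G x)%R ->
  \int[mu]_t (G (atan t) * (1 + t ^+ 2)^-1)%:E =
  \int[mu]_(x in `[(- (pi / 2))%R, (pi / 2)%R]) (G x)%:E.
Proof.
move=> cG G0.
have ca : continuous (@atan R) by move=> x; exact: continuous_atan.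
have cd : continuous (fun t : R => (1 + t ^+ 2)^-1)%R by exact: continuous_oneDsqrV.
have ch : continuous (fun t : R => G (atan t) * (1 + t ^+ 2)^-1)%R.
  move=> t; apply: cvgM; last exact: cd.
  by apply: continuous_comp; [exact: ca|exact: cG].
pose A (n : nat) := `[(- n%:R : R)%R, (n%:R : R)%R]%classic.
pose B (n : nat) := `[atan (- n%:R : R)%R, atan (n%:R : R)%R]%classic.
have AB n : \int[mu]_(t in A n) (G (atan t) * (1 + t ^+ 2)^-1)%:E =
            \int[mu]_(x in B n) (G x)%:E.
  rewrite [RHS](@integration_by_substitution_increasing _ atan).
  - by apply: eq_integral => t _; rewrite /= !fctE derive1_atan.
  - by rewrite lerNl (le_trans _ (ler0n _ n))// oppr_le0.
  - by move=> x y _ _; exact: lt_atan.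
  - by move=> x _; rewrite (funext (derive1_atan (R := R))); exact: cd.
  - apply: cvgP; rewrite (funext (derive1_atan (R := R))).
    exact/cvg_at_right_filter/cd.
  - apply: cvgP; rewrite (funext (derive1_atan (R := R))).
    exact/cvg_at_left_filter/cd.
  - split; first by move=> x _; exact: derivable_atan.
      exact/cvg_at_right_filter/ca.
    exact/cvg_at_left_filter/ca.
  - exact: continuous_subspaceT.
have cvA : \int[mu]_(t in A n) (G (atan t) * (1 + t ^+ 2)^-1)%:E @[n --> \oo] -->
    \int[mu]_t (G (atan t) * (1 + t ^+ 2)^-1)%:E.
  rewrite -bigcup_itv_setT.
  apply: ge0_nondecreasing_set_cvg_integral => //.
  - exact: (nondecreasing_itv_seq (e := id)).
  - move=> i; exact: measurable_itv.
  - move=> i; apply/measurable_EFinP/measurable_funTS.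
    exact: continuous_measurable_fun.
  - move=> i x _; rewrite lee_fin mulr_ge0// invr_ge0.
    by rewrite addr_ge0// sqr_ge0.
have cvB : \int[mu]_(x in B n) (G x)%:E @[n --> \oo] -->
    \int[mu]_(x in `](- (pi / 2))%R, (pi / 2)%R[) (G x)%:E.
  rewrite -bigcup_itv_atan.
  apply: ge0_nondecreasing_set_cvg_integral => //.
  - exact: (nondecreasing_itv_seq (@le_atan R)).
  - move=> i; exact: measurable_itv.
  - move=> i; apply/measurable_EFinP/measurable_funTS.
    exact: continuous_measurable_fun.
  - by move=> i x _; rewrite lee_fin.
rewrite (funext AB) in cvA.
rewrite (cvg_unique _ cvA cvB)//.
rewrite integral_itv_bndo_bndc ?integral_itv_obnd_cbnd//;
  apply/measurable_EFinP/measurable_funTS; exact: continuous_measurable_fun.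
Qed.

Lemma tonelli_prod (k : R * R -> \bar R) :
  measurable_fun [set: R * R] k -> (forall z, 0 <= k z) ->
  \int[mu \x mu]_z k z = \int[mu]_x \int[mu]_y k (x, y).
Proof. by move=> mk k0; exact: (@fubini_tonelli1 _ _ _ _ R mu mu k mk k0). Qed.

Lemma tonelli_swap (k : R * R -> \bar R) :
  measurable_fun [set: R * R] k -> (forall z, 0 <= k z) ->
  \int[mu]_x \int[mu]_y k (x, y) = \int[mu]_y \int[mu]_x k (x, y).
Proof. by move=> mk k0; exact: (@fubini_tonelli _ _ _ _ R mu mu k mk k0). Qed.

Lemma measurable_tonelli (k : R * R -> \bar R) :
  measurable_fun [set: R * R] k -> (forall z, 0 <= k z) ->
  measurable_fun [set: R] (fun x => \int[mu]_y k (x, y)).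
Proof.
by move=> mk k0; exact: (@measurable_fun_fubini_tonelli_F _ _ _ _ R mu k mk k0).
Qed.

Lemma measurable_fun_polar (k : R * R -> \bar R) :
  measurable_fun [set: R * R] k ->
  measurable_fun [set: R * R] (fun z : R * R =>
    k (z.1 * cos (atan z.2), z.1 * sin (atan z.2))%R *
    (`|z.1| * (1 + z.2 ^+ 2)^-1)%:E).
Proof.
move=> mk.
have mcos : measurable_fun [set: R] (fun t : R => cos (atan t)).
  apply: continuous_measurable_fun => t; apply: continuous_comp.
    exact: continuous_atan.
  exact: continuous_cos.
have msin : measurable_fun [set: R] (fun t : R => sin (atan t)).
  apply: continuous_measurable_fun => t; apply: continuous_comp.
    exact: continuous_atan.
  exact: continuous_sin.
have minv : measurable_fun [set: R] (fun t : R => (1 + t ^+ 2)^-1)%R.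
  by apply: continuous_measurable_fun; exact: continuous_oneDsqrV.
apply: emeasurable_funM.
  apply: (measurableT_comp mk); apply: measurable_fun_pair => //.
    by apply: measurable_funM => //; exact: (measurableT_comp mcos).
  by apply: measurable_funM => //; exact: (measurableT_comp msin).
apply/measurable_EFinP; apply: measurable_funM.
  by apply: (measurableT_comp (@normr_measurable R setT)).
exact: (measurableT_comp minv).
Qed.

(** The Jacobian s of polar coordinates comes from two dilations: y = x t
    contributes |x|, and x = s cos (atan t) turns |x| dx into
    cos (atan t)^2 |s| ds, where cos (atan t)^2 = 1 / (1 + t^2) is the density
    left over for the angle atan t.  The line x = 0, on which the first dilation
    degenerates, is negligible. *)
Lemma ge0_integral_polar (k : R * R -> \bar R) :
  measurable_fun [set: R * R] k -> (forall z, 0 <= k z) ->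
  \int[mu \x mu]_z k z =
  \int[mu]_s \int[mu]_t
    (k (s * cos (atan t), s * sin (atan t))%R * (`|s| * (1 + t ^+ 2)^-1)%:E).
Proof.
move=> mk k0.
pose k1 (z : R * R) := k (z.1, z.1 * z.2)%R * `|z.1|%:E.
have mk1 : measurable_fun [set: R * R] k1.
  apply: emeasurable_funM.
    apply: (measurableT_comp mk); apply: measurable_fun_pair => //.
    by apply: measurable_funM.
  by apply/measurable_EFinP; apply: (measurableT_comp (@normr_measurable R setT)).
have k10 z : 0 <= k1 z by rewrite mule_ge0// lee_fin.
pose k2 (z : R * R) := k (z.1 * cos (atan z.2), z.1 * sin (atan z.2))%R *
  (`|z.1| * (1 + z.2 ^+ 2)^-1)%:E.
have mk2 : measurable_fun [set: R * R] k2 by exact: measurable_fun_polar.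
have k20 z : 0 <= k2 z.
  by rewrite mule_ge0// lee_fin mulr_ge0// invr_ge0 addr_ge0// sqr_ge0.
apply: (etrans (tonelli_prod mk k0)).
transitivity (\int[mu]_x \int[mu]_t k1 (x, t)).
  apply: ae_eq_integral => //.
  - exact: measurable_fun_fubini_tonelli_F.
  - exact: measurable_fun_fubini_tonelli_F.
  (* The two integrands differ only at x = 0. *)
  exists [set 0%R]; split; [exact: measurable_set1|exact: lebesgue_measure_set1|].
  move=> x /=; apply: contra_notP => /eqP x0 _.
  rewrite /fubini_F (ge0_integral_dilation x0)//; last exact: measurableT_comp.
  rewrite -ge0_integralZl//.
    by apply: eq_integral => t _; rewrite /k1/= muleC.
  by apply: (measurableT_comp mk); apply: measurable_fun_pair => //;
    apply: measurable_funM.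
rewrite (tonelli_swap mk1 k10).
transitivity (\int[mu]_t \int[mu]_s k2 (s, t)); last first.
  by rewrite -(tonelli_swap mk2 k20).
apply: eq_integral => t _.
have c0 : (0 < cos (atan t))%R.
  by apply: cos_gt0_pihalf; rewrite atan_gtNpi2 atan_ltpi2.
have tE : ((1 + t ^+ 2)^-1 = cos (atan t) ^+ 2)%R.
  by rewrite -[in LHS](atanK t) -cos2_tan2 ?lt0r_neq0// invrK.
rewrite (ge0_integral_dilation (lt0r_neq0 c0))//; last exact: measurableT_comp.
rewrite -ge0_integralZl//.
  apply: eq_integral => s _; rewrite /k1 /k2/= muleCA -EFinM; congr (k _ * _%:E).
    rewrite mulrC; congr pair; rewrite -mulrA [(_ * t)%R]mulrC.
    rewrite -{1}(atanK t) /tan mulfVK ?lt0r_neq0//.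
  by rewrite tE normrM (gtr0_norm c0) mulrA -expr2 mulrC.
by apply: (measurableT_comp mk1); apply: measurable_fun_pair => //;
  apply: measurable_funM.
Qed.

Lemma ge0_integral_fold (g : R -> \bar R) :
  measurable_fun [set: R] g -> (forall x, 0 <= g x) ->
  \int[mu]_x g x = \int[mu]_(x in `[0%R, +oo[) (g x + g (- x)%R).
Proof.
move=> mg g0.
have mgN : measurable_fun [set: R] (fun x : R => g (- x)%R).
  by apply: (measurableT_comp mg); exact: measurable_funN.
rewrite ge0_integralD//; [|exact: measurable_funTS..].
rewrite (@ge0_integration_by_substitution0 _ (fun x => g (- x)%R))//.
under [in X in _ + X]eq_integral do rewrite opprK.
rewrite addeC -(@integral_itv_obnd_cbnd _ 0%R); last exact: measurable_funTS.
rewrite -ge0_integral_setU//=.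
- by rewrite -setCitvr setvU.
- by apply: measurable_funTS.
- rewrite disj_set2E; apply/eqP; rewrite -subset0 => x/=.
  by rewrite !in_itv/= andbT ltNge => -[-> ].
Qed.

Lemma measurable_disk (u : R) :
  measurable [set z : R * R | Num.sqrt (z.1 ^+ 2 + z.2 ^+ 2) <= u]%R.
Proof.
have mn : measurable_fun [set: R * R]
    (fun z : R * R => Num.sqrt (z.1 ^+ 2 + z.2 ^+ 2))%R.
  apply: (measurableT_comp (f := @Num.sqrt R)).
    by apply: continuous_measurable_fun; exact: sqrt_continuous.
  by apply: measurable_funD; apply: measurable_funX.
rewrite -[X in measurable X]setTI.
rewrite (_ : [set z | _] = (fun z : R * R =>
  Num.sqrt (z.1 ^+ 2 + z.2 ^+ 2))%R @^-1` `]-oo, u]); first exact: mn.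
by apply/seteqP; split => z /=; rewrite in_itv.
Qed.

(** In ge0_integral_polar the pair (s, t) covers the plane with s of either
    sign; the part s < 0 is folded back, whence the two antipodal values of h.
    Continuity in the angle is what allows the substitution by the arctangent. *)
Lemma ge0_integral_disk (h : R * R -> R) (u : R) : (0 <= u)%R ->
  measurable_fun [set: R * R] h -> (forall z, 0 <= h z)%R ->
  (forall s, continuous (fun x => h (s * cos x, s * sin x)%R)) ->
  \int[mu \x mu]_(z in [set z : R * R | Num.sqrt (z.1 ^+ 2 + z.2 ^+ 2) <= u]%R)
    (h z)%:E =
  \int[mu]_(s in `[0%R, u]) (s%:E *
    \int[mu]_(x in `[(- (pi / 2))%R, (pi / 2)%R])
      (h (s * cos x, s * sin x)%R + h (- s * cos x, - s * sin x)%R)%:E).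
Proof.
move=> u0 mh h0 ch.
set D := [set z | _].
have mD : measurable D by exact: measurable_disk.
rewrite integral_mkcond.
pose k := (EFin \o h) \_ D.
have mk : measurable_fun [set: R * R] k.
  by apply/(measurable_restrictT _ mD)/measurable_funTS/measurable_EFinP.
have k0 z : 0 <= k z by apply: erestrict_ge0 => *; rewrite lee_fin.
rewrite (ge0_integral_polar mk k0).
pose Phi s := \int[mu]_(x in `[(- (pi / 2))%R, (pi / 2)%R])
  (h (s * cos x, s * sin x)%R)%:E.
have kD s t : k (s * cos t, s * sin t)%R =
    ((EFin \o (fun s => h (s * cos t, s * sin t)%R)) \_ `[(- u)%R, u]) s.
  rewrite /k !patchE.
  have -> : ((s * cos t, s * sin t)%R \in D) = (s \in `[(- u)%R, u]%classic).
    apply/idP/idP; rewrite !inE /D /= !exprMn -mulrDr cos2Dsin2 mulr1 sqrtr_sqr;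
      by rewrite in_itv/= ler_norml.
  by [].
have polE s : \int[mu]_t
    (k (s * cos (atan t), s * sin (atan t))%R * (`|s| * (1 + t ^+ 2)^-1)%:E) =
    ((fun s => `|s|%:E * Phi s) \_ `[(- u)%R, u]) s.
  rewrite patchE; case: ifPn => su; last first.
    by rewrite integral0_eq// => t _; rewrite kD patchE (negbTE su) mul0e.
  rewrite /Phi -integral_atan//.
  rewrite -ge0_integralZl//.
  - apply: eq_integral => t _; rewrite kD patchE su /= -!EFinM; congr EFin; ring.
  - apply/measurable_EFinP; apply: measurable_funM.
      apply: continuous_measurable_fun => t.
      apply: (@continuous_comp _ _ _ (@atan R)
        (fun x => h (s * cos x, s * sin x)%R)); last exact: ch.
      exact: continuous_atan.
    by apply: continuous_measurable_fun; exact: continuous_oneDsqrV.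
  - by move=> t _; rewrite lee_fin mulr_ge0// invr_ge0 addr_ge0// sqr_ge0.
have Phi0 s : 0 <= Phi s by apply: integral_ge0 => x _; rewrite lee_fin.
under eq_integral do rewrite polE.
rewrite ge0_integral_fold; last 2 first.
- rewrite (_ : _ \_ _ = fun s => \int[mu]_t
    (k (s * cos (atan t), s * sin (atan t))%R * (`|s| * (1 + t ^+ 2)^-1)%:E)).
    apply: (measurable_tonelli (measurable_fun_polar mk)) => z.
    by rewrite mule_ge0// lee_fin mulr_ge0// invr_ge0 addr_ge0// sqr_ge0.
  by apply/funext => s; rewrite polE.
- by move=> s; apply: erestrict_ge0 => x _; rewrite mule_ge0.
rewrite [in RHS](_ : `[0%R, u]%classic = `[0%R, +oo[ `&` `[(- u)%R, u]); last first.
  apply/seteqP; split => x /=; rewrite !in_itv/= andbT.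
    move=> /andP[x0 xu]; rewrite x0 xu; split=> //; rewrite andbT.
    by rewrite (le_trans _ x0)// oppr_le0.
  by move=> [-> /andP[_ ->]].
rewrite [RHS]integral_mkcondr; apply: eq_integral => s; rewrite inE/= in_itv/= andbT => s0.
rewrite !patchE.
have -> : (- s \in `[- u, u]%classic)%R = (s \in `[- u, u]%classic)%R.
  by apply/idP/idP; rewrite !inE/= !in_itv/= lerN2 andbC (lerNl s).
case: ifPn => su; last by rewrite adde0.
rewrite normrN ger0_norm// -muleDr ?ge0_adde_def ?inE//.
have mhs (e : R) : measurable_fun `[(- (pi / 2))%R, (pi / 2)%R]
    (fun x => (h (e * cos x, e * sin x)%R)%:E).
  apply/measurable_EFinP; apply: measurable_funTS.
  by apply: continuous_measurable_fun; exact: ch.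
congr (_ * _); rewrite -ge0_integralD//.
- by move=> x _; rewrite lee_fin.
- exact: mhs.
- by move=> x _; rewrite lee_fin.
- exact: mhs.
Qed.

End polar_coordinates.

(** * Modified Bessel functions and the Jacobi-Anger expansion *)

Section cosine_powers.
Context {R : realType}.
Implicit Types (x z : R) (n j k : nat).

(** The coefficients of the Fourier expansion
    (2 cos x)^n / n! = sum_j eps_j cos(j x) cospow_coef n j.  The recursion is
    2 cos x cos(j x) = cos((j+1) x) + cos((j-1) x), with the frequency -1 folded
    onto 1. *)
Fixpoint cospow_coef n j : R :=
  if n is n'.+1 then
    (cospow_coef n' (if j is j'.+1 then j' else 1%N) + cospow_coef n' j.+1)
    / n%:R
  else (j == 0%N)%:R.

Lemma cospow_coef_ge0 n j : 0 <= cospow_coef n j.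
Proof.
elim: n j => [|n IH] j /=; first exact: ler0n.
by rewrite divr_ge0// addr_ge0.
Qed.

Lemma cospow_coef_small n j : (n < j)%N -> cospow_coef n j = 0.
Proof.
elim: n j => [|n IH] [|j]//= nj.
rewrite !IH ?addr0 ?mul0r//; lia.
Qed.

Lemma cospow_coef_odd n j : odd (n + j) -> cospow_coef n j = 0.
Proof.
elim: n j => [|n IH] [|j]//= nj; rewrite !IH ?addr0 ?mul0r//; lia.
Qed.

Lemma cospow_coefE k j : cospow_coef (k + k + j) j = (k`!%:R * (k + j)`!%:R)^-1.
Proof.
move: {2}(k + k + j)%N (erefl (k + k + j)%N) => n.
elim: n k j => [|n IH] k j nE.
  have -> : k = 0%N by lia.
  have -> : j = 0%N by lia.
  by rewrite /= fact0 mulr1 invr1.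
rewrite nE/=.
have n0 : n.+1%:R != 0 :> R by rewrite pnatr_eq0.
case: k nE => [|k] nE.
  case: j nE => [|j] nE; first by [].
  have -> : n = (0 + 0 + j)%N by lia.
  rewrite IH; last lia.
  rewrite cospow_coef_small; last lia.
  by rewrite addr0 !add0n fact0 factS natrM !mul1r invfM mulrC.
have cE : cospow_coef n j.+1 = (k`!%:R * (k + j).+1`!%:R)^-1.
  have -> : n = (k + k + j.+1)%N by lia.
  by rewrite IH; [rewrite addnS|lia].
have k0 : k`!%:R != 0 :> R by rewrite pnatr_eq0 -lt0n fact_gt0.
have kj0 : (k + j)`!%:R != 0 :> R by rewrite pnatr_eq0 -lt0n fact_gt0.
have k1 : k.+1%:R != 0 :> R by rewrite pnatr_eq0.
have kj1 : (k + j).+1%:R != 0 :> R by rewrite pnatr_eq0.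
rewrite cE; case: j nE cE kj0 kj1 => [|j] nE cE kj0 kj1.
  rewrite cE !addn0 !factS !natrM.
  have -> : n.+1 = (k.+1 + k.+1)%N by lia.
  rewrite natrD; field.
  by rewrite k0 nat1r k1 -natrD pnatr_eq0.
have -> : cospow_coef n j = (k.+1`!%:R * (k.+1 + j)`!%:R)^-1.
  have -> : n = (k.+1 + k.+1 + j)%N by lia.
  by rewrite IH//; lia.
have -> : (k.+1 + j.+1 = (k + j.+1).+1)%N by lia.
have -> : (k.+1 + j = k + j.+1)%N by lia.
rewrite !factS !natrM.
have -> : n.+1 = ((k + j.+1).+1 + k.+1)%N by lia.
have h : ((k + j.+1).+1 + k.+1)%:R != 0 :> R by rewrite pnatr_eq0.
rewrite natrD in h *; field.
by rewrite k0 kj0 /= nat1r -natrD nat1r nat1r -natrD !pnatr_eq0.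
Qed.

(** Multiplication by 2 cos x acts on the coefficients f by the recursion of
    cospow_coef; the last two terms are the boundary terms of the truncated sum,
    which vanish when f is zero beyond N. *)
Lemma cos_mul_sum x (f : nat -> R) N :
  2 * cos x * \sum_(0 <= j < N.+1) neumann j * cos (j%:R * x) * f j =
  \sum_(0 <= j < N.+2) neumann j * cos (j%:R * x) *
    (f (if j is j'.+1 then j' else 1%N) + f j.+1)
  - 2 * cos (N.+1%:R * x) * f N.+2 - 2 * cos (N%:R * x) * f N.+1.
Proof.
elim: N => [|N IH].
  rewrite !big_nat_recr//= !big_geq// /neumann/= !mul0r !mul1r cos0; ring.
rewrite big_nat_recr//= mulrDr IH [in RHS]big_nat_recr//=.
have -> : neumann N.+1 = 2 :> R by [].
have -> : neumann N.+2 = 2 :> R by [].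
have -> : N.+2%:R * x = N.+1%:R * x + x by rewrite -[N.+2]addn1 natrD; ring.
have -> : N%:R * x = N.+1%:R * x - x by rewrite -[N.+1]addn1 natrD; ring.
rewrite (cosD _ x) cosB; ring.
Qed.

Lemma cos_powE x n N : (n < N)%N -> (2 * cos x) ^+ n / n`!%:R =
  \sum_(0 <= j < N) neumann j * cos (j%:R * x) * cospow_coef n j.
Proof.
elim: n N => [|n IH] [//|N] nN.
  rewrite big_nat_recl// big1_seq ?addr0.
    by rewrite /neumann/= mul0r cos0 expr0 fact0 invr1 !mulr1.
  by move=> i _ /=; rewrite mulr0.
case: N nN => [//|N] nN /=.
have := cos_mul_sum x (cospow_coef n) N.
rewrite -IH// (@cospow_coef_small n N.+1)// (@cospow_coef_small n N.+2); last lia.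
rewrite !mulr0 !subr0.
under [in X in _ -> X]eq_bigr do rewrite mulrA.
rewrite -mulr_suml => <-.
rewrite exprS factS natrM invfM; ring.
Qed.

End cosine_powers.

Section bessel.
Context {R : realType}.
Implicit Types (x z : R) (n j k : nat).

Definition besselI_term j z k : R :=
  (z / 2) ^+ (k + k + j) / (k`!%:R * (k + j)`!%:R).

(** The modified Bessel function of the first kind, of integer order j. *)
Definition besselI j z : R := limn (series (besselI_term j z)).

Lemma besselI_term_ge0 j z k : 0 <= z -> 0 <= besselI_term j z k.
Proof. by move=> z0; rewrite divr_ge0 ?mulr_ge0// exprn_ge0// divr_ge0. Qed.

(** As n varies with j fixed, only n = 2k + j contributes, and the term is then
    that of the Bessel series. *)
Lemma series_cospow_coef j z K :
  series (fun n => (z / 2) ^+ n * cospow_coef n j) (K + K + j)%N =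
  series (besselI_term j z) K.
Proof.
elim: K => [|K IH].
  rewrite /series/= [RHS]big_geq// big1_seq// => i.
  rewrite mem_index_iota => /andP[_ ij]; rewrite cospow_coef_small ?mulr0//; lia.
have -> : (K.+1 + K.+1 + j = (K + K + j).+2)%N by lia.
rewrite !seriesSr IH cospow_coefE (@cospow_coef_odd R (K + K + j).+1).
  by rewrite mulr0 addr0.
by rewrite addSn/= !oddD; case: (odd K); case: (odd j).
Qed.

(** In the exponential series of exp z + exp (z cos x) each power is expanded by
    cos_powE, and the sum over the exponent n is then taken first.  Adding exp z replaces the weight cos(j x) by 1 + cos(j x), which is
    nonnegative, so that series_tonelli applies and no absolute convergence has
    to be proved first. *)
Lemma besselI_weighted x z : 0 <= z ->
  exists2 c : R^nat,
    forall j, (fun K => neumann j * (1 + cos (j%:R * x)) *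
                series (besselI_term j z) K) @ \oo --> c j &
    series c @ \oo --> expR z + expR (z * cos x).
Proof.
move=> z0.
pose a n j := neumann j * (1 + cos (j%:R * x)) * ((z / 2) ^+ n * cospow_coef n j).
have w0 j : 0 <= neumann j * (1 + cos (j%:R * x)) :> R.
  by rewrite mulr_ge0// /neumann; case: ifP.
have a0 n j : 0 <= a n j.
  by rewrite mulr_ge0 ?w0// mulr_ge0 ?cospow_coef_ge0// exprn_ge0// divr_ge0.
have row n : series (a n) @ \oo --> exp_coeff z n + exp_coeff (z * cos x) n.
  apply: cvg_near_cst; exists n.+1 => // N /= nN.
  rewrite /series/= /a.
  transitivity ((z / 2) ^+ n * ((2 * cos 0) ^+ n / n`!%:R + (2 * cos x) ^+ n / n`!%:R)).
    rewrite !(@cos_powE _ _ _ N)// -big_split/= big_distrr/=.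
    by apply: eq_bigr => j _; rewrite mulr0 cos0; ring.
  rewrite cos0 /exp_coeff/= mulr1 mulrDr !mulrA -!exprMn.
  by congr (_ ^+ _ / _ + _ ^+ _ / _); field.
have tot : series (fun n => exp_coeff z n + exp_coeff (z * cos x) n) @ \oo -->
    expR z + expR (z * cos x).
  by apply: cvg_seriesD; exact: is_cvg_series_exp_coeff.
have [c ac cS] := series_tonelli a0 row tot.
exists c => // j.
rewrite (_ : (fun K => _) = series (a^~ j) \o (fun K => K + K + j)%N).
  apply: cvg_comp (ac j) => /=.
  by apply/cvgnyPge => A; exists A => // K /= AK; lia.
by apply/funext => K /=; rewrite -series_cospow_coef /series/= big_distrr.
Qed.

(** At x = 0 the weights of besselI_weighted are positive, hence they can be
    divided out and the Bessel series themselves converge. *)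
Lemma besselI_cvg j z : 0 <= z ->
  series (besselI_term j z) @ \oo --> besselI j z.
Proof.
move=> /(@besselI_weighted 0)[c /(_ j) cj _].
apply/cvg_ex; exists ((neumann j * 2)^-1 * c j).
have n0 : neumann j * 2 != 0 :> R.
  by rewrite lt0r_neq0// /neumann; case: ifP => _; lra.
rewrite (_ : series _ = (fun K => (neumann j * 2)^-1 *
  (neumann j * (1 + cos (j%:R * 0)) * series (besselI_term j z) K))).
  exact: cvgMl_tmp.
by apply/funext => K; rewrite mulr0 cos0 [1 + 1]addrC mulKf.
Qed.

Lemma cvg_neumann_besselI x z : 0 <= z ->
  series (fun j => neumann j * (1 + cos (j%:R * x)) * besselI j z) @ \oo -->
    expR z + expR (z * cos x).
Proof.
move=> z0; have [c cj cS] := besselI_weighted x z0.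
suff -> : (fun j => neumann j * (1 + cos (j%:R * x)) * besselI j z) = c by [].
apply/funext => j; apply: cvg_unique (cj j) => //.
by apply: cvgMl_tmp; exact: besselI_cvg.
Qed.

Lemma cvg_series_neumann_besselI z : 0 <= z ->
  series (fun j => neumann j * besselI j z) @ \oo --> expR z.
Proof.
move=> z0; have := @cvg_neumann_besselI 0 z z0; rewrite cos0 mulr1.
move=> /(cvg_seriesM (c := 2^-1)); apply: eq_cvg_series; last by field.
by move=> j; rewrite mulr0 cos0; field.
Qed.

(** The expansions with weights 1 + cos(j x) and with weights 1 are both known;
    their difference is the expansion with weights cos(j x). *)
Lemma jacobi_anger x z : 0 <= z ->
  series (fun j => neumann j * besselI j z * cos (j%:R * x)) @ \oo -->
    expR (z * cos x).
Proof.
move=> z0.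
have := cvg_seriesB (@cvg_neumann_besselI x z z0) (cvg_series_neumann_besselI z0).
by apply: eq_cvg_series => [j|]; ring.
Qed.

Lemma neumann_ge1 j : 1 <= neumann j :> R.
Proof. by rewrite /neumann; case: ifP => _ //; rewrite ler1n. Qed.

Lemma besselI_ge0 j z : 0 <= z -> 0 <= besselI j z.
Proof.
move=> z0; have t0 k := besselI_term_ge0 j k z0.
exact: le_trans (t0 0%N) (series_ge0_le 0 t0 (@besselI_cvg j z z0)).
Qed.

Lemma besselI_le_expR j z : 0 <= z -> besselI j z <= expR z.
Proof.
move=> z0; apply: (@le_trans _ _ (neumann j * besselI j z)).
  by rewrite ler_peMl ?besselI_ge0// neumann_ge1.
apply: (series_ge0_le j _ (cvg_series_neumann_besselI z0)) => k.
by rewrite mulr_ge0 ?besselI_ge0// (le_trans _ (neumann_ge1 k)).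
Qed.

Lemma besselI_term_le j z y k : 0 <= z -> z <= y ->
  besselI_term j z k <= besselI_term j y k.
Proof.
move=> z0 zy; rewrite ler_wpM2r//.
by rewrite lerXn2r ?nnegrE ?divr_ge0 ?ler_wpM2r// (le_trans z0).
Qed.

Lemma besselI_le j z y : 0 <= z -> z <= y -> besselI j z <= besselI j y.
Proof.
move=> z0 zy; have y0 := le_trans z0 zy.
apply: lim_series_le; [exact: besselI_cvg|exact: besselI_cvg|].
by move=> k; exact: besselI_term_le.
Qed.

End bessel.

(** * The angular integral *)

Section angular.
Context {R : realType}.
Notation mu := (@lebesgue_measure R).
Implicit Types (x a b c d : R) (i j k n : nat).

Local Notation hp := `[- (pi / 2), (pi / 2 : R)]%classic.

Lemma cvg_series_single (f : R ^nat) n :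
  (forall k, k != n -> f k = 0) -> series f @ \oo --> f n.
Proof.
move=> f0; apply: cvg_near_cst; exists n.+1 => // N /= nN.
rewrite /series/= (bigD1_seq n) ?iota_uniq ?mem_index_iota//=.
by rewrite big1 ?addr0// => i; exact: f0.
Qed.

Lemma continuous_cos_affine (w c : R) : continuous (fun x => cos (w * (x + c))).
Proof.
move=> x; apply: continuous_comp; last exact: continuous_cos.
by apply: cvgM; [exact: cvg_cst|apply: cvgD; [exact: cvg_id|exact: cvg_cst]].
Qed.

Lemma Rintegral_cos_affine (w c a b : R) : a < b -> w != 0 ->
  \int[mu]_(x in `[a, b]) cos (w * (x + c)) =
  (sin (w * (b + c)) - sin (w * (a + c))) / w.
Proof.
move=> ab w0; rewrite /Rintegral.
pose F x := sin (w * (x + c)) / w.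
have dF x : is_derive x 1 F (cos (w * (x + c))).
  rewrite /F; apply: is_derive_eq.
  by rewrite scaler0 add0r addr0 /GRing.scale/= mulr1 mulrC mulfK.
rewrite (@continuous_FTC2 _ _ F)//.
- by rewrite -EFinB/= /F mulrBl.
- exact/continuous_subspaceT/continuous_cos_affine.
- have cF : continuous F.
    by move=> x; apply/differentiable_continuous/derivable1_diffP/ex_derive.
  split => [x _||]; first exact: ex_derive.
    exact/cvg_at_right_filter/cF.
  exact/cvg_at_left_filter/cF.
- by move=> x _; rewrite derive1E derive_val.
Qed.

Lemma pihalf_lt : - (pi / 2) < pi / 2 :> R.
Proof. by have := pi_gt0 R; lra. Qed.

Lemma integrable_continuous a b (f : R -> R) : continuous f ->
  mu.-integrable `[a, b] (EFin \o f).
Proof.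
move=> cf; apply: continuous_compact_integrable; first exact: segment_compact.
exact: continuous_subspaceT.
Qed.

Lemma sinDpin x n : sin (x + pi *+ n) = (-1) ^+ n * sin x.
Proof.
elim: n => [|n IH]; first by rewrite mulr0n addr0 mul1r.
by rewrite mulrSr addrA sinDpi IH exprS mulN1r mulNr.
Qed.

Lemma cosDpin x n : cos (x + pi *+ n) = (-1) ^+ n * cos x.
Proof.
elim: n => [|n IH]; first by rewrite mulr0n addr0 mul1r.
by rewrite mulrSr addrA cosDpi IH exprS mulN1r mulNr.
Qed.

(** An even frequency makes the half turn an exact multiple of the period. *)
Lemma Rintegral_cos_even n c : (0 < n)%N ->
  \int[mu]_(x in hp) cos ((2 * n)%:R * x + c) = 0.
Proof.
move=> n0; have w0 : (2 * n)%:R != 0 :> R by rewrite pnatr_eq0; lia.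
pose e := (2 * n)%:R^-1 * c.
transitivity (\int[mu]_(x in hp) cos ((2 * n)%:R * (x + e))).
  by apply: eq_Rintegral => x _; rewrite mulrDr mulVKf.
rewrite Rintegral_cos_affine ?pihalf_lt//.
have -> : (2 * n)%:R * (pi / 2 + e) =
  (2 * n)%:R * (- (pi / 2) + e) + pi *+ (2 * n).
  by rewrite -[pi *+ _]mulr_natl; field.
by rewrite sinDpin mulnC exprM sqrr_sign mul1r subrr mul0r.
Qed.

Lemma cos_mul_cos x y : cos x * cos y = (cos (x - y) + cos (x + y)) / 2 :> R.
Proof. by rewrite cosB cosD; field. Qed.

Lemma continuous_cos_shift (w c : R) : continuous (fun x => cos (w * x + c)).
Proof.
move=> x; apply: continuous_comp; last exact: continuous_cos.
by apply: cvgD; [apply: cvgM; [exact: cvg_cst|exact: cvg_id]|exact: cvg_cst].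
Qed.

Lemma Rintegral_cst_pi r : \int[mu]_(x in hp) r = pi * r.
Proof.
rewrite Rintegral_cst//= lebesgue_measure_itv/= lte_fin pihalf_lt/=.
by field.
Qed.

Lemma cos_orthogonal i j c d :
  \int[mu]_(x in hp) (cos ((2 * i)%:R * (x + c)) * cos ((2 * j)%:R * (x + d))) =
  if i == j then pi * cos ((2 * j)%:R * (c - d)) / neumann j else 0.
Proof.
wlog ij : i j c d / (j <= i)%N.
  move=> H; case: (leqP j i) => [|/ltnW] ij; first exact: H.
  under eq_Rintegral do rewrite mulrC.
  rewrite H// eq_sym; case: eqP => // ->.
  by rewrite -cosN -mulrN opprB.
have ->: \int[mu]_(x in hp) (cos ((2 * i)%:R * (x + c)) * cos ((2 * j)%:R * (x + d)))
  = (\int[mu]_(x in hp) cos ((2 * (i - j))%:R * x + ((2 * i)%:R * c - (2 * j)%:R * d))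
   + \int[mu]_(x in hp) cos ((2 * (i + j))%:R * x + ((2 * i)%:R * c + (2 * j)%:R * d)))
   / 2.
  rewrite -RintegralD//; [|by apply: integrable_continuous; exact: continuous_cos_shift..].
  rewrite -RintegralZr//; last first.
    apply: integrable_continuous => x.
    apply: cvgD; exact: continuous_cos_shift.
  apply: eq_Rintegral => x _; rewrite cos_mul_cos !natrM natrB// natrD.
  by congr ((cos _ + cos _) / 2); ring.
case: eqP => [->|/eqP nij]; last first.
  by rewrite !Rintegral_cos_even ?addr0 ?mul0r//; lia.
have -> : \int[mu]_(x in hp) cos ((2 * (j - j))%:R * x + ((2 * j)%:R * c - (2 * j)%:R * d))
   = pi * cos ((2 * j)%:R * (c - d)).
  rewrite -[RHS]Rintegral_cst_pi; apply: eq_Rintegral => x _.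
  by rewrite subnn muln0 mul0r add0r mulrBr.
rewrite /neumann; case: eqP => [->|/eqP j0].
  rewrite addn0 muln0 !mul0r addr0 cos0.
  under eq_Rintegral do rewrite mul0r add0r cos0.
  by rewrite Rintegral_cst_pi; field.
by rewrite Rintegral_cos_even ?addr0//; lia.
Qed.

Lemma cos_half_turn n x : cos (n%:R * x) + cos (n%:R * (x + pi)) =
  if odd n then 0 else 2 * cos (n%:R * x).
Proof.
rewrite mulrDr [_ * pi]mulr_natl cosDpin -signr_odd; case: odd => /=.
  by rewrite expr1 mulN1r subrr.
by rewrite expr0 mul1r; ring.
Qed.

(** This is 2 cosh (a cos x).  It is written with the two antipodal angles so
    that the Jacobi-Anger expansion is only needed for a nonnegative argument. *)
Let cosh2 a x : R := expR (a * cos x) + expR (a * cos (x + pi)).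

Lemma measurable_cosh2 c a : measurable_fun hp (fun x => cosh2 a (x + c)).
Proof.
apply: measurable_funTS; apply: continuous_measurable_fun => x; rewrite /cosh2.
have cc (e : R) : {for x, continuous (fun x => expR (a * cos (x + e)))}.
  apply: continuous_comp; last exact: continuous_expR.
  apply: cvgM; first exact: cvg_cst.
  apply: continuous_comp; last exact: continuous_cos.
  by apply: cvgD; [exact: cvg_id|exact: cvg_cst].
apply: cvgD; first exact: cc.
under eq_fun do rewrite -addrA.
rewrite -addrA; exact: cc.
Qed.

Lemma cosh2_le a x : 0 <= a -> `|cosh2 a x| <= 2 * expR a.
Proof.
move=> a0; rewrite ger0_norm ?addr_ge0 ?expR_ge0// mulr_natl mulr2n.
by apply: lerD; rewrite ler_expR ler_piMr// cos_le1.
Qed.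

(** The sum over the two antipodal angles kills the odd frequencies of the
    Jacobi-Anger expansion, and orthogonality on the half turn keeps only the
    frequency 2j among the even ones. *)
Lemma angular_moment j a c d : 0 <= a ->
  \int[mu]_(x in hp) (cosh2 a (x + c) * cos ((2 * j)%:R * (x + d))) =
  2 * pi * besselI (2 * j) a * cos ((2 * j)%:R * (c - d)).
Proof.
move=> a0.
pose f n x := neumann n * besselI n a *
  (cos (n%:R * (x + c)) + cos (n%:R * (x + c + pi))) * cos ((2 * j)%:R * (x + d)).
have := @cvg_series_Rintegral R (- (pi / 2)) (pi / 2) f
  (fun x => cosh2 a (x + c) * cos ((2 * j)%:R * (x + d)))
  (fun n => 2 * (neumann n * besselI n a)).
have nb n : 0 <= neumann n * besselI n a.
  by rewrite mulr_ge0 ?besselI_ge0// (le_trans _ (neumann_ge1 n)).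
case.
- move=> n; apply: measurable_funTS; apply: continuous_measurable_fun => x.
  rewrite /f; apply: cvgM; last exact: continuous_cos_affine.
  apply: cvgM; first exact: cvg_cst.
  apply: cvgD; first exact: continuous_cos_affine.
  under eq_fun do rewrite -addrA.
  rewrite -addrA; exact: continuous_cos_affine.
- move=> n x _; rewrite /f 2!normrM (ger0_norm (nb n)) [leRHS]mulrC.
  rewrite -[leRHS]mulr1; apply: ler_pM; rewrite ?cos_max//.
    by rewrite mulr_ge0// normr_ge0.
  apply: ler_wpM2l => //; apply: (le_trans (ler_normD _ _)).
  by rewrite (_ : 2 = 1 + 1)// lerD ?cos_max.
- by apply: cvgP; apply: cvg_seriesM; exact: cvg_series_neumann_besselI.
- move=> x _.
  have := cvg_seriesM (c := cos ((2 * j)%:R * (x + d)))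
    (cvg_seriesD (@jacobi_anger R (x + c) a a0) (@jacobi_anger R (x + c + pi) a a0)).
  by apply: eq_cvg_series => [n|]; rewrite /f /cosh2; ring.
move=> _ cv; apply: cvg_unique cv _ => //.
have fE n : \int[mu]_(x in hp) f n x = if n == (2 * j)%N then
    2 * pi * besselI (2 * j) a * cos ((2 * j)%:R * (c - d)) else 0.
  rewrite /f; under eq_Rintegral do rewrite cos_half_turn.
  case: (boolP (odd n)) => on.
    under eq_Rintegral do rewrite mulr0 mul0r.
    rewrite Rintegral_cst_pi mulr0; case: eqP => // nj.
    by move: on; rewrite nj mul2n odd_double.
  have [m ->] : exists m, n = (2 * m)%N.
    by exists n./2; rewrite mul2n even_halfK.
  transitivity (\int[mu]_(x in hp) (2 * neumann (2 * m) * besselI (2 * m) a *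
      (cos ((2 * m)%:R * (x + c)) * cos ((2 * j)%:R * (x + d))))).
    by apply: eq_Rintegral => x _; ring.
  rewrite RintegralZl//; last first.
    by apply: integrable_continuous => x; apply: cvgM;
      exact: continuous_cos_affine.
  rewrite cos_orthogonal (_ : (2 * m == 2 * j)%N = (m == j)); last lia.
  case: eqP => [->|]; last by rewrite mulr0.
  have -> : neumann (2 * j) = neumann j :> R by rewrite /neumann muln_eq0.
  by field; rewrite lt0r_neq0// (lt_le_trans _ (neumann_ge1 j)).
have := @cvg_series_single (fun n => \int[mu]_(x in hp) f n x) (2 * j).
by rewrite fE eqxx; apply => k /negbTE kj; rewrite fE kj.
Qed.

(** Only the factor exp (b cos(2 (x + d))) is expanded here; the other one is
    integrated against each of its harmonics by angular_moment. *)
Lemma angular_integral a b c d : 0 <= a -> 0 <= b ->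
  series (fun j => neumann j * besselI j b *
    (2 * pi * besselI (2 * j) a * cos ((2 * j)%:R * (c - d)))) @ \oo -->
  \int[mu]_(x in hp) (cosh2 a (x + c) * expR (b * cos (2 * (x + d)))).
Proof.
move=> a0 b0.
pose f j x := neumann j * besselI j b *
  (cosh2 a (x + c) * cos ((2 * j)%:R * (x + d))).
have mf j : measurable_fun hp (fun x => cosh2 a (x + c) * cos ((2 * j)%:R * (x + d))).
  apply: measurable_funM; first exact: measurable_cosh2.
  apply: measurable_funTS; apply: continuous_measurable_fun.
  exact: continuous_cos_affine.
have fb j x : `|cosh2 a (x + c) * cos ((2 * j)%:R * (x + d))| <= 2 * expR a.
  by rewrite normrM -[leRHS]mulr1 ler_pM ?cosh2_le ?cos_max.
have nb j : 0 <= neumann j * besselI j b.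
  by rewrite mulr_ge0 ?besselI_ge0// (le_trans _ (neumann_ge1 j)).
have := @cvg_series_Rintegral R (- (pi / 2)) (pi / 2) f
  (fun x => cosh2 a (x + c) * expR (b * cos (2 * (x + d))))
  (fun n => 2 * expR a * (neumann n * besselI n b)).
case.
- by move=> j; apply: measurable_funM.
- move=> j x _; rewrite /f normrM [leRHS]mulrC (ger0_norm (nb j)).
  exact: ler_wpM2l.
- by apply: cvgP; apply: cvg_seriesM; exact: cvg_series_neumann_besselI.
- move=> x _.
  have := cvg_seriesM (c := cosh2 a (x + c)) (@jacobi_anger R (2 * (x + d)) b b0).
  apply: eq_cvg_series => [n|//]; rewrite /f mulrA [_ * (2 * _)]mulrA -natrM [(n * 2)%N]mulnC; ring.
move=> _; apply: eq_cvg_series => [j|//].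
rewrite -angular_moment// -RintegralZl//.
by apply: (@bounded_integrable _ _ _ (2 * expR a)).
Qed.

End angular.

(** * The radial integral *)

Section kummer_integral.
Context {R : realType}.
Notation mu := (@lebesgue_measure R).

Lemma Rintegral_exprn (n : nat) (u : R) : 0 < u ->
  \int[mu]_(x in `[0, u]) (x ^+ n) = u ^+ n.+1 / n.+1%:R.
Proof.
move=> u0; rewrite /Rintegral.
pose F (x : R) := x ^+ n.+1 / n.+1%:R.
have n0 : n.+1%:R != 0 :> R by rewrite pnatr_eq0.
have dF (x : R) : is_derive x 1 F (x ^+ n).
  rewrite (_ : F = n.+1%:R^-1 \*: ((@id R) ^+ n.+1)); last first.
    apply/funext => y; by rewrite /F mulrC exprfctE.
  apply: is_derive_eq.
  by rewrite /GRing.scale/= mulr1 mulrA mulVf ?mul1r.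
rewrite (@continuous_FTC2 _ _ F)//.
- by rewrite -EFinB/= /F expr0n/= mul0r subr0.
- by apply: continuous_subspaceT => x; exact: exprn_continuous.
- have cF : continuous F.
    by move=> x; apply/differentiable_continuous/derivable1_diffP/ex_derive.
  split => [x _||]; first exact: ex_derive.
    exact/cvg_at_right_filter/cF.
  exact/cvg_at_left_filter/cF.
- by move=> x _; rewrite derive1E derive_val.
Qed.

Lemma prod_shift_ratio (a : R) n : 0 < a ->
  (\prod_(i < n) (a + i%:R)) / (\prod_(i < n) (a + 1 + i%:R)) = a / (a + n%:R).
Proof.
move=> a0; have ai i : a + i%:R != 0 by rewrite lt0r_neq0// ltr_wpDr.
have ai1 i : a + 1 + i%:R != 0 by rewrite lt0r_neq0// ltr_wpDr// addr_gt0.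
elim: n => [|n IH]; first by rewrite !big_ord0 addr0 divr1 divff ?lt0r_neq0.
rewrite !big_ord_recr/= -mulf_div IH.
have e : a + n.+1%:R = a + 1 + n%:R by rewrite -natr1; ring.
rewrite e; field.
by rewrite ai ai1.
Qed.

Lemma continuous_expR_sqr (b : R) : continuous (fun s : R => expR (- b * s ^+ 2)).
Proof.
move=> s; apply: continuous_comp; last exact: continuous_expR.
by apply: cvgM; [exact: cvg_cst|exact: exprn_continuous].
Qed.

(** Integrating the exponential series term by term gives
    u^(2l+2+2n) / (2 (l+1+n)), and (l+1) / (l+1+n) is the ratio of the rising
    factorials of l+1 and l+2. *)
Lemma Rintegral_kummer (l : nat) (b u : R) : 0 < u ->
  2 * \int[mu]_(s in `[0, u]) (s ^+ (2 * l + 1) * expR (- b * s ^+ 2)) =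
  u ^+ (2 * l + 2) / (l%:R + 1) * kummer (l%:R + 1) (l%:R + 2) (- b * u ^+ 2).
Proof.
move=> u0.
pose f n s := s ^+ (2 * l + 1) * exp_coeff (- b * s ^+ 2) n.
have cf n : continuous (f n).
  move=> s; apply: cvgM; first exact: exprn_continuous.
  rewrite /exp_coeff/=; apply: cvgM; last exact: cvg_cst.
  apply: (continuous_comp (f := fun s : R => - b * s ^+ 2)
    (g := fun x : R => x ^+ n)); last exact: exprn_continuous.
  by apply: cvgM; [exact: cvg_cst|exact: exprn_continuous].
have [] := @cvg_series_Rintegral R 0 u f
  (fun s => s ^+ (2 * l + 1) * expR (- b * s ^+ 2))
  (fun n => u ^+ (2 * l + 1) * exp_coeff (`|b| * u ^+ 2) n).
- by move=> n; apply: measurable_funTS; exact: continuous_measurable_fun.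
- move=> n s; rewrite in_itv/= => /andP[s0 su].
  rewrite /f /exp_coeff/= normrM ger0_norm ?exprn_ge0//.
  apply: ler_pM; rewrite ?exprn_ge0//.
    by rewrite lerXn2r// nnegrE ltW.
  rewrite normrM normrX normrM normrN [X in _ * X]ger0_norm ?invr_ge0//.
  rewrite ler_wpM2r ?invr_ge0// lerXn2r ?nnegrE ?mulr_ge0 ?normr_ge0 ?exprn_ge0 ?(ltW u0)//.
  by rewrite ler_wpM2l// ger0_norm ?exprn_ge0// lerXn2r// nnegrE ltW.
- apply: cvgP; apply: cvg_seriesM; exact: is_cvg_series_exp_coeff.
- by move=> s _; apply: cvg_seriesM; exact: is_cvg_series_exp_coeff.
move=> _ cv.
have l0 : l%:R + 1 != 0 :> R by rewrite natr1 pnatr_eq0.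
have uk0 : u ^+ (2 * l + 2) != 0 by rewrite expf_neq0 ?lt0r_neq0.
rewrite /kummer.
have := cvg_seriesM (c := 2 * (l%:R + 1) / u ^+ (2 * l + 2)) cv.
move/cvg_lim => /(_ (@Rhausdorff R)) cl.
rewrite (_ : series _ = series (fun n => 2 * (l%:R + 1) / u ^+ (2 * l + 2) *
  \int[mu]_(x in `[0, u]) f n x)).
  by rewrite cl; field; rewrite l0 uk0.
congr series; apply/funext => n.
have -> : l%:R + 2 = l%:R + 1 + 1 :> R by ring.
rewrite prod_shift_ratio; last by rewrite ltr_wpDl.
have -> : \int[mu]_(x in `[0, u]) f n x =
    (- b) ^+ n / n`!%:R * (u ^+ (2 * l + 1 + 2 * n).+1 / (2 * l + 1 + 2 * n).+1%:R).
  rewrite -Rintegral_exprn// -RintegralZl//; last first.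
    by apply: integrable_continuous => x; exact: exprn_continuous.
  apply: eq_Rintegral => s _; rewrite /f /exp_coeff/= exprMn -exprM [s ^+ (_ + 2 * n)]exprD; ring.
have -> : (2 * l + 1 + 2 * n).+1 = (2 * l + 2 + 2 * n)%N by lia.
have -> : (2 * l + 2 + 2 * n)%:R = 2 * (l%:R + 1 + n%:R) :> R.
  by rewrite natr1 -natrD -natrM; congr (_%:R); lia.
rewrite exprMn -exprM (exprD u (2 * l + 2)).
have n0 : n`!%:R != 0 :> R by rewrite pnatr_eq0 -lt0n fact_gt0.
have ln0 : l%:R + 1 + n%:R != 0 :> R by rewrite natr1 -natrD pnatr_eq0.
by field; rewrite uk0 n0 ln0.
Qed.

End kummer_integral.

Section bessel_core.
Context {R : realType}.
Implicit Types (y z : R) (j k : nat).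

(** The Bessel series without the factor (y/2)^j.  The inner series of the
    statement do not contain the factor (eta psi^2 / 8)^j, which may be zero, so
    their convergence cannot be deduced from that of the Bessel series of psi s
    and eta s^2; it is deduced from these. *)
Definition bessel_core_term j y k : R :=
  (y / 2) ^+ (2 * k) / (k`!%:R * (k + j)`!%:R).

Definition bessel_core j y : R := limn (series (bessel_core_term j y)).

Lemma bessel_core_term_ge0 j y k : 0 <= bessel_core_term j y k.
Proof. by rewrite divr_ge0 ?mulr_ge0// exprM exprn_ge0// sqr_ge0. Qed.

Lemma bessel_core_cvg j y : 0 <= y ->
  series (bessel_core_term j y) @ \oo --> bessel_core j y.
Proof.
move=> y0; have : cvgn (series (besselI_term 0 y)).
  exact: cvgP (@besselI_cvg R 0%N y y0).
apply: series_le_cvg => k; [exact: bessel_core_term_ge0|exact: besselI_term_ge0|].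
rewrite /bessel_core_term /besselI_term !addn0 mul2n -addnn.
rewrite ler_wpM2l ?exprn_ge0 ?divr_ge0// lef_pV2 ?posrE ?mulr_gt0 ?ltr0n ?fact_gt0//.
rewrite ler_wpM2l// ler_nat -(bin_fact (leq_addr j k)) addKn mulnCA.
by rewrite leq_pmulr// muln_gt0 bin_gt0 leq_addr fact_gt0.
Qed.

Lemma besselI_core j z : 0 <= z -> besselI j z = (z / 2) ^+ j * bessel_core j z.
Proof.
move=> z0; have := cvg_seriesM (c := (z / 2) ^+ j) (@bessel_core_cvg j z z0).
move/cvg_lim => <-//; congr (limn (series _)); apply/funext => k.
by rewrite /besselI_term /bessel_core_term addnn -mul2n addnC exprD; ring.
Qed.

Lemma bessel_core_term_le j z y k : 0 <= z -> z <= y ->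
  bessel_core_term j z k <= bessel_core_term j y k.
Proof.
move=> z0 zy; rewrite ler_wpM2r//.
by rewrite lerXn2r ?nnegrE ?divr_ge0 ?ler_wpM2r// (le_trans z0).
Qed.

Lemma bessel_core_ge0 j y : 0 <= y -> 0 <= bessel_core j y.
Proof.
move=> y0; have t0 k := bessel_core_term_ge0 j y k.
exact: le_trans (t0 0%N) (series_ge0_le 0 t0 (@bessel_core_cvg j y y0)).
Qed.

Lemma bessel_core_le j z y : 0 <= z -> z <= y -> bessel_core j z <= bessel_core j y.
Proof.
move=> z0 zy; have y0 := le_trans z0 zy.
apply: lim_series_le; [exact: cvgP (bessel_core_cvg _)..|].
by move=> k; exact: bessel_core_term_le.
Qed.

End bessel_core.

Section radial.
Context {R : realType}.
Notation mu := (@lebesgue_measure R).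
Variables (b e p u : R).
Hypotheses (b0 : 0 <= b) (e0 : 0 <= e) (p0 : 0 <= p) (u0 : 0 < u).

Let w j (s : R) := 2 * s ^+ (4 * j + 1) * expR (- b * s ^+ 2).

Let w_bound j s : s \in `[0, u] -> 0 <= w j s <= 2 * u ^+ (4 * j + 1).
Proof.
rewrite in_itv/= => /andP[s0 su].
rewrite mulr_ge0 ?expR_ge0 ?mulr_ge0 ?exprn_ge0//=.
rewrite -[leRHS]mulr1 ler_pM ?mulr_ge0 ?exprn_ge0 ?expR_ge0//.
  by rewrite ler_wpM2l// lerXn2r// nnegrE ltW.
by rewrite -expR0 ler_expR mulNr oppr_le0 mulr_ge0// sqr_ge0.
Qed.

Let es_bound s : s \in `[0, u] -> 0 <= e * s ^+ 2 /\ e * s ^+ 2 <= e * u ^+ 2.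
Proof.
rewrite in_itv/= => /andP[s0 su]; split; first by rewrite mulr_ge0// sqr_ge0.
by rewrite ler_wpM2l// lerXn2r// nnegrE ltW.
Qed.

Let ps_bound s : s \in `[0, u] -> 0 <= p * s /\ p * s <= p * u.
Proof.
rewrite in_itv/= => /andP[s0 su]; split; first by rewrite mulr_ge0.
by rewrite ler_wpM2l.
Qed.

Definition radial_term (j k1 k2 : nat) : R :=
  let l := ell k1 k2 j in
  Ccoef k1 k2 j p e * (u ^+ (2 * l + 2) / (l%:R + 1)) *
  kummer (l%:R + 1) (l%:R + 2) (- b * u ^+ 2).

(** By Rintegral_kummer the terms of the triple series are the integrals of f2;
    f1 and f0 are the integrands once the sum over k2, and then the sum over k1,
    has been carried out. *)
Let f2 j k1 k2 s := w j s * bessel_core_term (2 * j) (p * s) k1 *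
  bessel_core_term j (e * s ^+ 2) k2.
Let f1 j k1 s := w j s * bessel_core_term (2 * j) (p * s) k1 *
  bessel_core j (e * s ^+ 2).
Let f0 j s := w j s * bessel_core (2 * j) (p * s) * bessel_core j (e * s ^+ 2).

Let measurable_f2 j k1 k2 : measurable_fun [set: R] (f2 j k1 k2).
Proof.
apply: continuous_measurable_fun => s; rewrite /f2 /w /bessel_core_term.
apply: cvgM; [apply: cvgM; [apply: cvgM|]|].
- by apply: cvgM; [exact: cvg_cst|exact: exprn_continuous].
- exact: continuous_expR_sqr.
- apply: cvgM; last exact: cvg_cst.
  apply: (continuous_comp (f := fun s : R => p * s / 2)
    (g := fun x : R => x ^+ (2 * k1))); last exact: exprn_continuous.
  apply: cvgM; last exact: cvg_cst.
  by apply: cvgM; [exact: cvg_cst|exact: cvg_id].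
- apply: cvgM; last exact: cvg_cst.
  apply: (continuous_comp (f := fun s : R => e * s ^+ 2 / 2)
    (g := fun x : R => x ^+ (2 * k2))); last exact: exprn_continuous.
  apply: cvgM; last exact: cvg_cst.
  by apply: cvgM; [exact: cvg_cst|exact: exprn_continuous].
Qed.

Let radial_termE j k1 k2 :
  radial_term j k1 k2 = \int[mu]_(s in `[0, u]) f2 j k1 k2 s.
Proof.
rewrite /radial_term /= -mulrA -Rintegral_kummer// mulrA -RintegralZl//; last first.
  apply: integrable_continuous => s; apply: cvgM; first exact: exprn_continuous.
  exact: continuous_expR_sqr.
apply: eq_Rintegral => s _; rewrite /f2 /w /Ccoef /bessel_core_term /ell.
(* The exponent 2l + 1 splits into the powers of s of the three factors. *)
have -> : (2 * (k1 + 2 * k2 + 2 * j) + 1 = 4 * j + 1 + 2 * k1 + 2 * (2 * k2))%N by lia.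
have h4 : 4 ^+ (k1 + k2) = 2 ^+ (2 * k1) * 2 ^+ (2 * k2) :> R.
  by rewrite -exprD -mulnDr exprM; congr (_ ^+ _); ring.
have hp (x y : R) n : (x * y / 2) ^+ n = x ^+ n * y ^+ n / 2 ^+ n.
  by rewrite !exprMn exprVn.
have f_neq0 n : n`!%:R != 0 :> R by rewrite pnatr_eq0 -lt0n fact_gt0.
have two_neq0 n : 2 ^+ n != 0 :> R by rewrite expf_neq0.
rewrite !hp h4 (exprD s (4 * j + 1 + 2 * k1)) (exprD s (4 * j + 1)) -(exprM s 2).
by field; rewrite !f_neq0 !two_neq0.
Qed.

Let ler_prod3 (x y z x' y' z' : R) : 0 <= x <= x' -> 0 <= y -> y <= y' ->
  0 <= z -> z <= z' -> `|x * y * z| <= x' * y' * z'.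
Proof.
move=> /andP[x0 xx] y0 yy z0 zz; rewrite ger0_norm ?mulr_ge0//.
by apply: ler_pM; rewrite ?mulr_ge0//; apply: ler_pM.
Qed.

Let inner_stage j k1 : mu.-integrable `[0, u] (EFin \o f1 j k1) /\
  series (radial_term j k1) @ \oo --> \int[mu]_(s in `[0, u]) f1 j k1 s.
Proof.
rewrite (_ : radial_term j k1 = fun k2 => \int[mu]_(s in `[0, u]) f2 j k1 k2 s); last first.
  by apply/funext => k2; exact: radial_termE.
apply: (@cvg_series_Rintegral R 0 u (f2 j k1) (f1 j k1) (fun k2 =>
  2 * u ^+ (4 * j + 1) * bessel_core_term (2 * j) (p * u) k1 *
  bessel_core_term j (e * u ^+ 2) k2)).
- by move=> k2; apply: measurable_funTS; exact: measurable_f2.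
- move=> k2 s su; have [es es'] := es_bound su; have [ps ps'] := ps_bound su.
  apply: ler_prod3; [exact: w_bound|exact: bessel_core_term_ge0|
    exact: bessel_core_term_le|exact: bessel_core_term_ge0|].
  exact: bessel_core_term_le.
- apply: cvgP; apply: cvg_seriesM; apply: bessel_core_cvg.
  by rewrite mulr_ge0// sqr_ge0.
- move=> s su; apply: cvg_seriesM; apply: bessel_core_cvg.
  by have [] := es_bound su.
Qed.

Let middle_stage j : mu.-integrable `[0, u] (EFin \o f0 j) /\
  series (fun k1 => \int[mu]_(s in `[0, u]) f1 j k1 s) @ \oo -->
  \int[mu]_(s in `[0, u]) f0 j s.
Proof.
have eu0 : 0 <= e * u ^+ 2 by rewrite mulr_ge0// sqr_ge0.
have pu0 : 0 <= p * u by rewrite mulr_ge0// ltW.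
apply: (@cvg_series_Rintegral R 0 u (f1 j) (f0 j) (fun k1 =>
  2 * u ^+ (4 * j + 1) * bessel_core_term (2 * j) (p * u) k1 *
  bessel_core j (e * u ^+ 2))).
- by move=> k1; have [/integrable_measurable_fun] := inner_stage j k1.
- move=> k1 s su; have [es es'] := es_bound su; have [ps ps'] := ps_bound su.
  apply: ler_prod3; [exact: w_bound|exact: bessel_core_term_ge0| |
    exact: bessel_core_ge0|exact: bessel_core_le]; exact: bessel_core_term_le.
- apply: cvgP.
  have := cvg_seriesM (c := 2 * u ^+ (4 * j + 1) * bessel_core j (e * u ^+ 2))
    (@bessel_core_cvg R (2 * j) _ pu0).
  by apply: eq_cvg_series => [k1|//]; ring.
- move=> s su; have [es es'] := es_bound su; have [ps ps'] := ps_bound su.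
  have := cvg_seriesM (c := w j s * bessel_core j (e * s ^+ 2))
    (@bessel_core_cvg R (2 * j) _ ps).
  by apply: eq_cvg_series => [k1|]; rewrite /f1 /f0; ring.
Qed.

Lemma radial_inner_cvg j k1 : cvgn (series (radial_term j k1)).
Proof. by have [_ /cvgP] := inner_stage j k1. Qed.

Let radial_middleE j :
  (fun k1 => limn (series (radial_term j k1))) =
  (fun k1 => \int[mu]_(s in `[0, u]) f1 j k1 s).
Proof.
by apply/funext => k1; have [_ /cvg_lim ->] := inner_stage j k1.
Qed.

Lemma radial_middle_cvg j :
  cvgn (series (fun k1 => limn (series (radial_term j k1)))).
Proof. by rewrite radial_middleE; have [_ /cvgP] := middle_stage j. Qed.

(** Multiplying by (e p^2 / 8)^j restores the powers (e s^2 / 2)^j and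
    (p s / 2)^(2j) that turn the core series into the Bessel functions. *)
Let radial_besselE j :
  (e * p ^+ 2 / 8) ^+ j *
    limn (series (fun k1 => limn (series (radial_term j k1)))) =
  \int[mu]_(s in `[0, u]) (2 * s * expR (- b * s ^+ 2) *
     besselI (2 * j) (p * s) * besselI j (e * s ^+ 2)) /\
  measurable_fun `[0, u] (fun s => 2 * s * expR (- b * s ^+ 2) *
     besselI (2 * j) (p * s) * besselI j (e * s ^+ 2)).
Proof.
have eu0 : 0 <= e * u ^+ 2 by rewrite mulr_ge0// sqr_ge0.
have pu0 : 0 <= p * u by rewrite mulr_ge0// ltW.
have [mf cv] := middle_stage j.
have E s : s \in `[0, u] -> 2 * s * expR (- b * s ^+ 2) *
     besselI (2 * j) (p * s) * besselI j (e * s ^+ 2) =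
     (e * p ^+ 2 / 8) ^+ j * f0 j s.
  move=> su; have [es _] := es_bound su; have [ps _] := ps_bound su.
  rewrite !besselI_core// /f0 /w.
  have -> : (4 * j + 1 = 1 + 2 * j + 2 * j)%N by ring.
  rewrite (exprD s (1 + 2 * j)) (exprD s 1) expr1.
  have -> : (p * s / 2) ^+ (2 * j) = (p ^+ 2 * s ^+ 2 / 4) ^+ j.
    by rewrite exprM; congr (_ ^+ j); field.
  have -> : s ^+ (2 * j) = (s ^+ 2) ^+ j by rewrite exprM.
  transitivity (((p ^+ 2 * s ^+ 2 / 4) ^+ j * (e * s ^+ 2 / 2) ^+ j) *
    (2 * s * expR (- b * s ^+ 2) * bessel_core (2 * j) (p * s) *
     bessel_core j (e * s ^+ 2))); first by ring.
  rewrite -exprMn (_ : p ^+ 2 * s ^+ 2 / 4 * (e * s ^+ 2 / 2) =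
    e * p ^+ 2 / 8 * (s ^+ 2 * s ^+ 2)); last by field.
  by rewrite !exprMn; ring.
split.
  rewrite radial_middleE (cvg_lim _ cv)// -RintegralZl//.
  by apply: eq_Rintegral => s; rewrite inE => su; rewrite E.
apply: (eq_measurable_fun (fun s => (e * p ^+ 2 / 8) ^+ j * f0 j s)).
  by move=> s; rewrite inE => su; rewrite E.
by apply: measurable_funM => //; exact: integrable_measurable_fun mf.
Qed.

(** The sum over j: it is dominated by a multiple of the convergent series of
    the eps_j I_j(e u^2), the factor I_2j(p s) being at most exp (p u). *)
Lemma radial_outer (c : R ^nat) (G : R -> R) : (forall j, `|c j| <= 1) ->
  {in `[0, u], forall s, series (fun j => neumann j * c j *
     (besselI j (e * s ^+ 2) * besselI (2 * j) (p * s))) @ \oo --> G s} ->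
  mu.-integrable `[0, u] (EFin \o (fun s => 2 * s * expR (- b * s ^+ 2) * G s)) /\
  series (fun j => neumann j * c j * (e * p ^+ 2 / 8) ^+ j *
    limn (series (fun k1 => limn (series (radial_term j k1))))) @ \oo -->
  \int[mu]_(s in `[0, u]) (2 * s * expR (- b * s ^+ 2) * G s).
Proof.
move=> c1 cG.
have eu0 : 0 <= e * u ^+ 2 by rewrite mulr_ge0// sqr_ge0.
have pu0 : 0 <= p * u by rewrite mulr_ge0// ltW.
pose g j s := 2 * s * expR (- b * s ^+ 2) *
     besselI (2 * j) (p * s) * besselI j (e * s ^+ 2).
have gb j s : s \in `[0, u] ->
    `|g j s| <= 2 * u * expR (p * u) * besselI j (e * u ^+ 2).
  move=> su; have [es es'] := es_bound su; have [ps ps'] := ps_bound su.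
  apply: ler_prod3; [|exact: besselI_ge0| |exact: besselI_ge0|exact: besselI_le].
    by have := w_bound 0 su; rewrite /w muln0 add0n !expr1.
  by rewrite (le_trans (besselI_le_expR _ ps))// ler_expR.
have n0 j : 0 <= neumann j :> R by exact: le_trans (neumann_ge1 j).
have mg j : measurable_fun `[0, u] (g j) by have [] := radial_besselE j.
have := @cvg_series_Rintegral R 0 u (fun j s => neumann j * c j * g j s)
  (fun s => 2 * s * expR (- b * s ^+ 2) * G s)
  (fun j => 2 * u * expR (p * u) * (neumann j * besselI j (e * u ^+ 2))).
case.
- by move=> j; apply: measurable_funM.
- move=> j s su; rewrite 2!normrM (ger0_norm (n0 j)).
  rewrite (_ : 2 * u * _ * _ =
    neumann j * 1 * (2 * u * expR (p * u) * besselI j (e * u ^+ 2))); last by ring.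
  apply: ler_pM; rewrite ?mulr_ge0 ?normr_ge0 ?n0//; last exact: gb.
  by rewrite ler_wpM2l.
- by apply: cvgP; apply: cvg_seriesM; exact: cvg_series_neumann_besselI.
- move=> s su; have := cvg_seriesM (c := 2 * s * expR (- b * s ^+ 2)) (cG s su).
  by apply: eq_cvg_series => [j|//]; rewrite /g; ring.
move=> iG cv; split=> //; move: cv; apply: eq_cvg_series => [j|//].
rewrite RintegralZl//; last first.
  by apply: (@bounded_integrable _ _ _
    (2 * u * expR (p * u) * besselI j (e * u ^+ 2))) => // s; exact: gb.
by have [<- _] := radial_besselE j; rewrite mulrA.
Qed.

End radial.

(** * The bivariate normal density in polar form *)

Section gaussian_density.
Context {R : realType}.
Variables mu1 mu2 s1 s2 rho : R.
Hypotheses (s1_gt0 : 0 < s1) (s2_gt0 : 0 < s2) (rho_lt1 : `|rho| < 1).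

Let Delta := s1 ^+ 2 * s2 ^+ 2 * (1 - rho ^+ 2).

Let rho2_gt0 : 0 < 1 - rho ^+ 2.
Proof.
by rewrite subr_gt0 -real_normK ?num_real// expr_lt1.
Qed.

Let Delta_gt0 : 0 < Delta.
Proof. by rewrite !mulr_gt0 ?exprn_gt0. Qed.

Let s1_neq0 : s1 != 0. Proof. exact: lt0r_neq0. Qed.
Let s2_neq0 : s2 != 0. Proof. exact: lt0r_neq0. Qed.
Let rho2_neq0 : 1 - rho ^+ 2 != 0. Proof. exact: lt0r_neq0. Qed.

Lemma det_cov2 : \det (cov2 s1 s2 rho) = s1 ^+ 2 * s2 ^+ 2 * (1 - rho ^+ 2).
Proof.
rewrite (expand_det_row _ ord0) !big_ord_recl big_ord0 /cofactor !det_mx11 !mxE /=.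
ring.
Qed.

Definition cov2_inv : 'M[R]_2 := \matrix_(i, j)
  ((if i == j then (if i == ord0 then s2 else s1) ^+ 2 else - (rho * s1 * s2))
   / Delta).

Lemma invmx_cov2 : invmx (cov2 s1 s2 rho) = cov2_inv.
Proof.
have h : cov2 s1 s2 rho *m cov2_inv = 1%:M.
  apply/matrixP => i j; rewrite !mxE !big_ord_recl big_ord0 !mxE.
  case: i => [[|[|//]] ?]; case: j => [[|[|//]] ?] /=; rewrite /Delta;
    by field; rewrite rho2_neq0 s1_neq0 s2_neq0.
have [uS _] := mulmx1_unit h.
by rewrite -[RHS](mulKmx uS) h mulmx1.
Qed.

Lemma normal2_pdfE (x : R * R) :
  normal2_pdf (vec2 mu1 mu2) (cov2 s1 s2 rho) x =
  alpha mu1 mu2 s1 s2 rho / (2 * pi) *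
  expR (- (s2 ^+ 2 * x.1 ^+ 2 - 2 * rho * s1 * s2 * x.1 * x.2
           + s1 ^+ 2 * x.2 ^+ 2) / (2 * Delta)
        + ((mu1 * s2 ^+ 2 - rho * mu2 * s1 * s2) * x.1
           + (mu2 * s1 ^+ 2 - rho * mu1 * s1 * s2) * x.2) / Delta).
Proof.
have D0 := lt0r_neq0 Delta_gt0.
have pi0 := lt0r_neq0 (pi_gt0 R).
have sq0 : Num.sqrt (1 - rho ^+ 2) != 0 by rewrite lt0r_neq0// sqrtr_gt0.
have sqE : Num.sqrt (s1 ^+ 2 * s2 ^+ 2 * (1 - rho ^+ 2)) =
    s1 * s2 * Num.sqrt (1 - rho ^+ 2).
  by rewrite -exprMn sqrtrM ?sqr_ge0// sqrtr_sqr gtr0_norm// mulr_gt0.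
rewrite /normal2_pdf invmx_cov2 det_cov2 /alpha sqE.
rewrite [RHS]mulrAC -[X in _ = X / _]mulrA -expRD.
set a := expR _; set a' := expR _.
suff -> : a = a'.
  (* pi is generalized because field would open its definition. *)
  by move: (pi : R) pi0 => q q0; field; rewrite sq0 q0 s1_neq0 s2_neq0.
congr expR; rewrite !mxE !big_ord_recl big_ord0 !mxE !big_ord_recl !big_ord0 !mxE /=.
rewrite /Delta; field.

by rewrite rho2_neq0 s1_neq0 s2_neq0.
Qed.

Lemma measurable_normal2_pdf : measurable_fun [set: R * R]
  (normal2_pdf (vec2 mu1 mu2) (cov2 s1 s2 rho)).
Proof.
rewrite (funext normal2_pdfE); apply: measurable_funM => //.
apply: measurableT_comp; first exact: measurable_expR.
have mx : measurable_fun [set: R * R] (fun x : R * R => x.1) by exact: measurable_fst.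
have my : measurable_fun [set: R * R] (fun x : R * R => x.2) by exact: measurable_snd.
apply: measurable_funD; apply: measurable_funM => //.
  apply: measurableT_comp; first exact: measurable_funN.
  apply: measurable_funD; last by apply: measurable_funM => //; exact: measurable_funX.
  apply: measurable_funB; first by apply: measurable_funM => //; exact: measurable_funX.
  by apply: measurable_funM => //; apply: measurable_funM.
by apply: measurable_funD; apply: measurable_funM.
Qed.

Let psi_den : psi mu1 mu2 s1 s2 rho = phit_den mu1 mu2 s1 s2 rho / Delta.
Proof. by rewrite /psi /phit_den; congr (Num.sqrt _ / _); ring. Qed.

Let eta_den : Defs.eta s1 s2 rho = phi_den s1 s2 rho / (4 * Delta).
Proof. by rewrite /Defs.eta /phi_den /Delta !mulrA; congr (Num.sqrt _ / _); ring. Qed.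

Lemma psi_ge0 : 0 <= psi mu1 mu2 s1 s2 rho.
Proof. by rewrite psi_den divr_ge0 ?sqrtr_ge0// ltW. Qed.

Lemma eta_ge0 : 0 <= Defs.eta s1 s2 rho.
Proof. by rewrite eta_den divr_ge0 ?sqrtr_ge0// mulr_ge0// ltW. Qed.

Lemma beta_ge0 : 0 <= beta s1 s2 rho.
Proof.
rewrite /beta divr_ge0 ?addr_ge0 ?sqr_ge0//.
by rewrite !mulr_ge0 ?sqr_ge0// ltW.
Qed.

(** When the denominator of the angle vanishes so do psi and both coordinates
    of the linear form, hence the angle may be arbitrary. *)
Lemma psi_angle phit : is_phit mu1 mu2 s1 s2 rho phit ->
  psi mu1 mu2 s1 s2 rho * cos phit =
    (mu2 * s1 ^+ 2 - rho * mu1 * s1 * s2) / Delta /\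
  psi mu1 mu2 s1 s2 rho * sin phit =
    (mu1 * s2 ^+ 2 - rho * mu2 * s1 * s2) / Delta.
Proof.
rewrite /is_phit psi_den; have [d0 _|d0 /(_ isT)[-> ->]] := eqVneq (phit_den _ _ _ _ _) 0.
  have : (mu2 * s1 ^+ 2 - rho * mu1 * s1 * s2) ^+ 2 +
         (mu1 * s2 ^+ 2 - rho * mu2 * s1 * s2) ^+ 2 == 0.
    move/eqP: (d0); rewrite /phit_den sqrtr_eq0 => le0.
    rewrite eq_le addr_ge0 ?sqr_ge0// andbT; apply: le_trans le0.
    by rewrite le_eqVlt; apply/orP; left; apply/eqP; ring.
  rewrite paddr_eq0 ?sqr_ge0// !sqrf_eq0 => /andP[/eqP -> /eqP ->].
  by rewrite d0 !mul0r.
by split; field; rewrite d0 lt0r_neq0.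
Qed.

(** As for psi_angle, with the traceless part of the quadratic form. *)
Lemma eta_angle phi : is_phi s1 s2 rho phi ->
  Defs.eta s1 s2 rho * cos phi = (s2 ^+ 2 - s1 ^+ 2) / (4 * Delta) /\
  Defs.eta s1 s2 rho * sin phi = (2 * rho * s1 * s2) / (4 * Delta).
Proof.
rewrite /is_phi eta_den; have [d0 _|d0 /(_ isT)[-> ->]] := eqVneq (phi_den _ _ _) 0.
  have : (s2 ^+ 2 - s1 ^+ 2) ^+ 2 + (2 * rho * s1 * s2) ^+ 2 == 0.
    move/eqP: (d0); rewrite /phi_den sqrtr_eq0 => le0.
    rewrite eq_le addr_ge0 ?sqr_ge0// andbT; apply: le_trans le0.
    by rewrite le_eqVlt; apply/orP; left; apply/eqP; ring.
  rewrite paddr_eq0 ?sqr_ge0// !sqrf_eq0 => /andP[/eqP -> /eqP ->].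
  by rewrite d0 !mul0r.
by split; field; rewrite d0 lt0r_neq0.
Qed.

(** The shift of the angle by phit - pi / 2 makes the linear form a cosine; it
    turns cos(2x + phi) into the opposite of cos(2 (x' - delta)), which absorbs
    the sign of the quadratic form. *)
Lemma normal2_pdf_polar phit phi s x :
  is_phit mu1 mu2 s1 s2 rho phit -> is_phi s1 s2 rho phi ->
  let delta := phit - phi / 2 in let c := phit - pi / 2 in
  normal2_pdf (vec2 mu1 mu2) (cov2 s1 s2 rho) (s * cos x, s * sin x) =
  alpha mu1 mu2 s1 s2 rho / (2 * pi) * expR (- beta s1 s2 rho * s ^+ 2) *
  (expR (psi mu1 mu2 s1 s2 rho * s * cos (x + c)) *
   expR (Defs.eta s1 s2 rho * s ^+ 2 * cos (2 * (x + (c - delta))))).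
Proof.
move=> /psi_angle[pc ps] /eta_angle[ec es] delta c.
have D0 := lt0r_neq0 Delta_gt0.
rewrite normal2_pdfE/= -[RHS]mulrA -!expRD; congr (_ * expR _).
have -> : cos (x + c) = sin x * cos phit + cos x * sin phit.
  by rewrite /c addrA cosBpihalf sinD.
have -> : 2 * (x + (c - delta)) = (x + x) + phi - pi.
  by rewrite /c /delta; field.
have cosBpi (y : R) : cos (y - pi) = - cos y.
  by rewrite cosB cospi sinpi mulrN1 mulr0 addr0.
rewrite cosBpi cosD cosD sinD.
transitivity (- beta s1 s2 rho * s ^+ 2 +
  (s * (sin x * (psi mu1 mu2 s1 s2 rho * cos phit) +
        cos x * (psi mu1 mu2 s1 s2 rho * sin phit)) -
   s ^+ 2 * ((cos x * cos x - sin x * sin x) * (Defs.eta s1 s2 rho * cos phi) -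
    (sin x * cos x + cos x * sin x) * (Defs.eta s1 s2 rho * sin phi)))); last by ring.
rewrite pc ps ec es /beta.
have -> : 4 * s1 ^+ 2 * s2 ^+ 2 * (1 - rho ^+ 2) = 4 * Delta by rewrite /Delta; ring.
have e1 : s ^+ 2 = s ^+ 2 * (cos x ^+ 2 + sin x ^+ 2) by rewrite cos2Dsin2 mulr1.
rewrite [in - ((s1 ^+ 2 + _) / _) * _]e1.
by field.
Qed.

Lemma normal2_pdf_ge0 z : 0 <= normal2_pdf (vec2 mu1 mu2) (cov2 s1 s2 rho) z.
Proof.
rewrite /normal2_pdf mulr_ge0 ?expR_ge0// invr_ge0 mulr_ge0 ?sqrtr_ge0//.
by rewrite mulr_ge0// pi_ge0.
Qed.

End gaussian_density.

(** * The distribution function of the radius *)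

Section main_formula.
Context {R : realType}.
Notation mu := (@lebesgue_measure R).

Lemma cdf_radiusE (d : measure_display) (T : measurableType d)
    (P : probability T R) (X : {RV P >-> (R * R)%type}) (m : 'cV[R]_2)
    (Sigma : 'M[R]_2) (u : R) : is_normal2 X m Sigma ->
  cdf (radiusRV X) u =
  (\int[mu \x mu]_(z in [set z : R * R |
     (Num.sqrt (z.1 ^+ 2 + z.2 ^+ 2) <= u)%R]) (normal2_pdf m Sigma z)%:E)%E.
Proof.
move=> X_normal; rewrite -X_normal; last exact: measurable_disk.
by rewrite /cdf /distribution /pushforward; congr (P _).
Qed.

Lemma continuous_expR_cos (a w c : R) :
  continuous (fun x => expR (a * cos (w * (x + c)))).
Proof.
move=> x; apply: (@continuous_comp _ _ _ (fun x => a * cos (w * (x + c))) expR).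
  by apply: cvgM; [exact: cvg_cst|exact: continuous_cos_affine].
exact: continuous_expR.
Qed.

Lemma EFin_Rintegral_continuous (a b : R) (g : R -> R) : continuous g ->
  (\int[mu]_(x in `[a, b]) (g x)%:E = (\int[mu]_(x in `[a, b]) g x)%:E)%E.
Proof.
move=> cg; rewrite /Rintegral fineK//; apply: integrable_fin_num => //.
exact: integrable_continuous.
Qed.

End main_formula.

Theorem proposition1 (R : realType) (d : measure_display) (T : measurableType d)
    (P : probability T R) (X : {RV P >-> (R * R)%type})
    (mu1 mu2 s1 s2 rho phit phi : R)
    (s1_gt0 : 0 < s1) (s2_gt0 : 0 < s2) (rho_lt1 : `|rho| < 1)
    (X_normal : is_normal2 X (vec2 mu1 mu2) (cov2 s1 s2 rho))
    (phitP : is_phit mu1 mu2 s1 s2 rho phit) (phiP : is_phi s1 s2 rho phi) :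
  let delta := phit - phi / 2 in
  (forall u : R, 0 < u ->
    [/\ forall j k1 : nat, cvgn (series (inner_term mu1 mu2 s1 s2 rho u j k1)),
        forall j : nat, cvgn (series (middle_term mu1 mu2 s1 s2 rho u j)),
        cvgn (series (outer_term mu1 mu2 s1 s2 rho delta u))
      & cdf (radiusRV X) u =
        (alpha mu1 mu2 s1 s2 rho / 2 *
         limn (series (outer_term mu1 mu2 s1 s2 rho delta u)))%:E]) /\
  (forall u : R, u <= 0 -> cdf (radiusRV X) u = 0%E).
Proof.
move=> delta.
set f := normal2_pdf (vec2 mu1 mu2) (cov2 s1 s2 rho).
have f_ge0 z : 0 <= f z by exact: normal2_pdf_ge0.
have mf : measurable_fun [set: R * R] f by exact: measurable_normal2_pdf.
pose c := phit - pi / 2.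
have f_polar s x := normal2_pdf_polar s1_gt0 s2_gt0 rho_lt1 s x phitP phiP.
have cf s : continuous (fun x => f (s * cos x, s * sin x)).
  rewrite /f; under eq_fun do rewrite f_polar.
  move=> x; apply: cvgM; first exact: cvg_cst.
  apply: cvgM; last exact: continuous_expR_cos.
  under eq_fun do rewrite -[_ + c]mul1r.
  rewrite -[x + c]mul1r; exact: continuous_expR_cos.
have cdfE u : 0 <= u -> cdf (radiusRV X) u =
    (\int[lebesgue_measure]_(s in `[0%R, u]) (s%:E *
     \int[lebesgue_measure]_(x in `[(- (pi / 2))%R, (pi / 2)%R])
      (f (s * cos x, s * sin x)%R + f (- s * cos x, - s * sin x)%R)%:E))%E.
  by move=> u0; rewrite (cdf_radiusE _ X_normal) ge0_integral_disk.
split=> u u0; last first.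
  move: u0; rewrite le_eqVlt => /predU1P[->|u0].
    (* For u = 0 the radial integral is over a single point. *)
    by rewrite cdfE// set_itv1 integral_set1.
  rewrite (cdf_radiusE _ X_normal) (_ : [set z | _] = set0) ?integral_set0//.
  apply/seteqP; split => // z /= zu.
  by have := le_lt_trans zu u0; rewrite ltNge sqrtr_ge0.
set b := beta s1 s2 rho; set e := Defs.eta s1 s2 rho; set p := psi mu1 mu2 s1 s2 rho.
have b0 : 0 <= b by exact: beta_ge0.
have e0 : 0 <= e by exact: eta_ge0.
have p0 : 0 <= p by exact: psi_ge0.
pose A s := \int[lebesgue_measure]_(x in `[(- (pi / 2)), (pi / 2)])
  ((expR (p * s * cos (x + c)) + expR (p * s * cos (x + c + pi))) *
   expR (e * s ^+ 2 * cos (2 * (x + (c - delta))))).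
pose cs j : R := cos (2 * j%:R * delta).
have cG : {in `[0, u], forall s, series (fun j => neumann j * cs j *
    (besselI j (e * s ^+ 2) * besselI (2 * j) (p * s))) @ \oo --> A s / (2 * pi)}.
  move=> s; rewrite in_itv/= => /andP[s0 _].
  have ps0 : 0 <= p * s by rewrite mulr_ge0.
  have es0 : 0 <= e * s ^+ 2 by rewrite mulr_ge0// sqr_ge0.
  have := cvg_seriesM (c := (2 * pi)^-1) (@angular_integral R _ _ c (c - delta) ps0 es0).
  apply: eq_cvg_series => [j|]; last by rewrite mulrC.
  rewrite /cs natrM (_ : c - (c - delta) = delta); last by ring.
  (* pi is generalized because field would open its definition. *)
  have := lt0r_neq0 (pi_gt0 R); move: (pi : R) => q q0.
  by field.
have cs1 j : `|cs j| <= 1 by exact: cos_max.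
have [iG cvG] := radial_outer b0 e0 p0 u0 cs1 cG.
have outerE : outer_term mu1 mu2 s1 s2 rho delta u = fun j =>
    neumann j * cs j * (e * p ^+ 2 / 8) ^+ j *
    limn (series (fun k1 => limn (series (radial_term b e p u j k1)))) by [].
split.
- by move=> j k1; exact: (radial_inner_cvg b0 e0 p0 u0).
- by move=> j; exact: (radial_middle_cvg b0 e0 p0 u0).
- by rewrite outerE; exact: cvgP cvG.
rewrite outerE (cvg_lim _ cvG)// -RintegralZl// cdfE; last exact: ltW.
rewrite /Rintegral fineK; last first.
  apply: integrable_fin_num => //.
  by apply: (integrableZl _ _ iG).
apply: eq_integral => s _; set K := alpha mu1 mu2 s1 s2 rho / (2 * pi) * expR (- b * s ^+ 2).
pose g x := (expR (p * s * cos (x + c)) + expR (p * s * cos (x + c + pi))) *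
   expR (e * s ^+ 2 * cos (2 * (x + (c - delta)))).
have cg : continuous g.
  move=> x; apply: cvgM; last exact: continuous_expR_cos.
  apply: cvgD.
    under eq_fun do rewrite -[_ + c]mul1r.
    rewrite -[x + c]mul1r; exact: continuous_expR_cos.
  under eq_fun do rewrite -addrA -[_ + (c + pi)]mul1r.
  rewrite -addrA -[x + (c + pi)]mul1r; exact: continuous_expR_cos.
(* Replacing s by - s turns the angle by pi and leaves the double angle fixed. *)
have fE x : f (s * cos x, s * sin x) + f (- s * cos x, - s * sin x) = K * g x.
  rewrite /f !f_polar sqrrN -/b -/p -/e -/K -mulrDr; congr (_ * _).
  rewrite /g [RHS]mulrDl; congr (_ + _ * _); congr expR.
  by rewrite cosDpi -/c; ring.
under eq_integral do rewrite fE.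
rewrite EFin_Rintegral_continuous; last first.
  by move=> x; apply: cvgM; [exact: cvg_cst|exact: cg].
rewrite RintegralZl//; last exact: integrable_continuous.
rewrite -EFinM -/(A s) /K; congr EFin.
(* As above, pi is made opaque to field. *)
have := lt0r_neq0 (pi_gt0 R); move: (A s) => a.
by move: (pi : R) => q q0; field.
Qed.
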